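(* Let $(\bar x,\bar\lambda)=(\bar x^1,\dots,\bar x^N,\bar\lambda^1,\dots,\bar\lambda^N)\in S_{\rm KKT}(\bar p)$. Suppose that: (i) the NEP satisfies the convex assumptions; (ii) the SMFCQ holds at $(\bar p^k,\bar x^k,\bar\lambda^k)$ for each player $k$; (iii) the NEP satisfies the P-property at $(\bar p,\bar x,\bar\lambda)$ on $K(I_1,I_2)$. Then $S_{\rm KKT}$ is robust isolated calm at $\bar p$ for $(\bar x,\bar\lambda)$, and for every $(p,x(p),\lambda(p))\in{\rm gph}\,S_{\rm KKT}$ sufficiently close to $(\bar p,\bar x,\bar\lambda)$, $x(p)$ is a Nash equilibrium at $p$.
   Context: Nash equilibrium problem (NEP) with canonical perturbations. There are $N$ players; player $k$ has strategy $x^k\in\mathbb R^{n_k}$; $x=(x^1,\dots,x^N)\in\mathbb R^n$, $n=n_1+\cdots+n_N$; $x^{-k}$ denotes the other players' strategies. Parameters: $p^k=(u^k,v^k,w^k)\in\mathbb R^{m_k}\times\mathbb R^{n_k}\times\mathbb R^{d_k}$, $p=(p^1,\dots,p^N)$, identified with $(u,v,w)\in\mathbb R^{m}\times\mathbb R^n\times\mathbb R^d$, $m=\sum m_k$, $d=\sum d_k$. Given $x^{-k},p^k$, player $k$ solves the problem $\mathbf P^k(x^{-k},p^k)$: $$\min_{x^k}\ f^k(x^k,x^{-k};w^k)-\langle v^k,x^k\rangle\ \text{ s.t. } g^k_i(x^k;w^k)=u^k_i\ (i=1,\dots,s_k),\ \ g^k_j(x^k;w^k)\le u^k_j\ (j=s_k+1,\dots,m_k),$$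 with $f^k\in C^2(\mathbb R^n\times\mathbb R^{d_k})$, $g^k_i\in C^2(\mathbb R^{n_k}\times\mathbb R^{d_k})$. A point $x$ is a Nash equilibrium (NE) at $p$ if each $x^k$ is a (global) minimizer of $\mathbf P^k(x^{-k},p^k)$. Lagrangian: $L^k(x^k,x^{-k},\lambda^k;w^k)=f^k(x^k,x^{-k};w^k)+\sum_{i=1}^{m_k}\lambda^k_ig^k_i(x^k;w^k)$. KKT mapping: $S_{\rm KKT}(p)$ is the set of $(x,\lambda)\in\mathbb R^n\times\mathbb R^m$ such that for each $k$: $v^k=\nabla_{x^k}L^k(x^k,x^{-k},\lambda^k;w^k)$; $g^k_i(x^k;w^k)=u^k_i$ for $i\le s_k$; and $\lambda^k_j\ge0$, $g^k_j(x^k;w^k)\le u^k_j$, $\lambda^k_j(g^k_j(x^k;w^k)-u^k_j)=0$ for $j>s_k$. Convex assumptions: for each $k$, $f^k(\cdot,x^{-k};w^k)$ is convex for any fixed $w^k,x^{-k}$; $g^k_i(\cdot;w^k)$ is affine for any fixed $w^k$, $i=1,\dots,s_k$; $g^k_j(\cdot;w^k)$ is convex for any fixed $w^k$, $j=s_k+1,\dots,m_k$. Notation at $(\bar p,\bar x,\bar\lambda)\in{\rm gph}\,S_{\rm KKT}$: $\nabla^2_{x^kx^i}L^k\in\mathbb R^{n_k\times n_i}$ is the matrix of second partials $\partial^2L^k/\partial x^k_a\partial x^i_b$ evaluated at $(\bar x^k,\bar x^{-k},\bar\lambda^k;\bar w^k)$. Index sets: $I^k_1=\{1,\dots,s_k\}\cup\{i\in[s_k+1,m_k]:\bar\lambda^k_i>0=g^k_i(\bar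 x^k;\bar w^k)-\bar u^k_i\}$, $I^k_2=\{i\in[s_k+1,m_k]:\bar\lambda^k_i=0=g^k_i(\bar x^k;\bar w^k)-\bar u^k_i\}$. $K(I_1,I_2)=\{y=(y^1,\dots,y^N)\in\mathbb R^n:\nabla_{x^k}g^k_i(\bar x^k;\bar w^k)^{\mathrm T}y^k=0\ \forall i\in I^k_1,\ \nabla_{x^k}g^k_i(\bar x^k;\bar w^k)^{\mathrm T}y^k\le0\ \forall i\in I^k_2,\ k=1,\dots,N\}$. SMFCQ for player $k$ at $(\bar p^k,\bar x^k,\bar\lambda^k)$: the vectors $\nabla_{x^k}g^k_i(\bar x^k;\bar w^k)$, $i\in I^k_1$, are linearly independent, and there is $z\in\mathbb R^{n_k}$ with $\nabla_{x^k}g^k_i(\bar x^k;\bar w^k)^{\mathrm T}z=0$ for all $i\in I^k_1$ and $<0$ for all $i\in I^k_2$. P-property at $(\bar p,\bar x,\bar\lambda)$ on $K(I_1,I_2)$: for any $0\ne y\in K(I_1,I_2)$, $$\max_{k=1,\dots,N}\Big[\sum_{i\ne k}(y^k)^{\mathrm T}\nabla^2_{x^kx^i}L^k\,y^i+\tfrac12(y^k)^{\mathrm T}\nabla^2_{x^kx^k}L^k\,y^k\Big]>0 .$$ A set-valued mapping $\Phi$ is robust isolated calm at $\bar a$ for $\bar b$ if $\bar b\in\Phi(\bar a)$ and there are $\kappa\ge0$ and open neighborhoods $U$ of $\bar a$, $V$ of $\bar b$ with $\emptyset\neq\Phi(a)\cap V\subset\{\bar b\}+\kappa\|a-\bar a\|\mathbb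 B$ for all $a\in U$, where $\mathbb B$ is the unit ball. *)

(* Defs.v *)
From HB Require Import structures.
From mathcomp Require Import all_boot all_order all_algebra.
From mathcomp Require Import all_classical all_reals all_analysis.

Set Implicit Arguments.
Unset Strict Implicit.
Unset Printing Implicit Defensive.

Import Order.TTheory GRing.Theory Num.Theory.
Import numFieldNormedType.Exports.

Local Open Scope classical_set_scope.
Local Open Scope ring_scope.

(* Vectors are row vectors, normed by the library's sup norm, with the max norm
   on products.  The norm only enters through robust isolated calmness, which
   does not depend on the choice among equivalent norms (only kappa does). *)

Definition dotrow (R : realType) (n : nat) (a b : 'rV[R]_n) : R :=
  (a *m b^T) 0 0.

(* The class C^j, meant for a finite-dimensional domain E, where continuity of
   every directional derivative amounts to continuity of the differential. *)
Fixpoint Cdiff (R : realType) (E : normedModType R) (j : nat) (F : E -> R)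
    : Prop :=
  if j is j'.+1 then
    (forall x, differentiable F x) /\ (forall v, Cdiff j' (fun x => 'D_v F x))
  else continuous F.

Definition grad (R : realType) (n : nat) (F : 'rV[R]_n -> R) (x : 'rV[R]_n)
    : 'rV[R]_n :=
  \row_a 'D_(delta_mx 0 a) F x.

Definition hess (R : realType) (n : nat) (F : 'rV[R]_n -> R) (x : 'rV[R]_n)
    : 'M[R]_n :=
  \matrix_(a, b) 'D_(delta_mx 0 a) (fun y => 'D_(delta_mx 0 b) F y) x.

Definition affine_fun (R : realType) (n : nat) (F : 'rV[R]_n -> R) : Prop :=
  exists (a : 'rV[R]_n) (c : R), forall z, F z = dotrow a z + c.

Definition robust_isolated_calm (R : realType) (E F : normedModType R)
    (Phi : E -> set F) (abar : E) (bbar : F) : Prop :=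
  Phi abar bbar /\
  exists kappa : R, 0 <= kappa /\
  exists (U : set E) (V : set F), open_nbhs abar U /\ open_nbhs bbar V /\
    forall a, U a ->
      Phi a `&` V !=set0 /\
      Phi a `&` V `<=`
        [set bbar + (kappa * `|a - abar|) *: z | z in [set z : F | `|z| <= 1]].

(* A concatenation x = (x^1, ..., x^N) is a single row vector whose k-th block
   x^k is [submxrow x k].  Indices start at 0, so the equality constraints of
   player k are the i with i < neqc k.  [cost k (x, w)] is f^k(x^k, x^{-k}; w)
   and [constr k i (z, w)] is g^k_i(z; w). *)
Record NEP (R : realType) := MkNEP {
  nplayers : nat;
  dimx : 'I_nplayers -> nat;
  dimu : 'I_nplayers -> nat;
  dimw : 'I_nplayers -> nat;
  neqc : 'I_nplayers -> nat;
  neqc_le : forall k, (neqc k <= dimu k)%N;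
  cost : forall k, 'rV[R]_(\sum_j dimx j) * 'rV[R]_(dimw k) -> R;
  constr : forall k, 'I_(dimu k) -> 'rV[R]_(dimx k) * 'rV[R]_(dimw k) -> R;
  cost_C2 : forall k, Cdiff 2 (@cost k);
  constr_C2 : forall k i, Cdiff 2 (@constr k i)
}.

Arguments nplayers {R} _.
Arguments dimx {R} _ _.
Arguments dimu {R} _ _.
Arguments dimw {R} _ _.
Arguments neqc {R} _ _.
Arguments cost {R} _ _ _.
Arguments constr {R} _ _ _ _.

Definition strat (R : realType) (G : NEP R) : normedModType R :=
  'rV[R]_(\sum_j dimx G j).

Definition mult (R : realType) (G : NEP R) : normedModType R :=
  'rV[R]_(\sum_j dimu G j).

(* p = (u, v, w) in R^m * R^n * R^d *)
Definition param (R : realType) (G : NEP R) : normedModType R :=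
  ('rV[R]_(\sum_j dimu G j) * 'rV[R]_(\sum_j dimx G j)
   * 'rV[R]_(\sum_j dimw G j))%type.

Definition upar (R : realType) (G : NEP R) (p : param G) (k : 'I_(nplayers G))
    : 'rV[R]_(dimu G k) := submxrow p.1.1 k.
Definition vpar (R : realType) (G : NEP R) (p : param G) (k : 'I_(nplayers G))
    : 'rV[R]_(dimx G k) := submxrow p.1.2 k.
Definition wpar (R : realType) (G : NEP R) (p : param G) (k : 'I_(nplayers G))
    : 'rV[R]_(dimw G k) := submxrow p.2 k.

Definition xblock (R : realType) (G : NEP R) (x : strat G)
    (k : 'I_(nplayers G)) : 'rV[R]_(dimx G k) := submxrow x k.
Definition lblock (R : realType) (G : NEP R) (l : mult G)
    (k : 'I_(nplayers G)) : 'rV[R]_(dimu G k) := submxrow l k.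

(* (z, x^{-k}) *)
Definition deviate (R : realType) (G : NEP R) (x : strat G)
    (k : 'I_(nplayers G)) (z : 'rV[R]_(dimx G k)) : strat G :=
  \mxrow_j dfwith (xblock x) k z j.

Definition feasible (R : realType) (G : NEP R) (k : 'I_(nplayers G))
    (p : param G) (z : 'rV[R]_(dimx G k)) : Prop :=
  forall i : 'I_(dimu G k),
    if (i < neqc G k)%N then constr G k i (z, wpar p k) = upar p k 0 i
    else constr G k i (z, wpar p k) <= upar p k 0 i.

Definition objective (R : realType) (G : NEP R) (k : 'I_(nplayers G))
    (x : strat G) (p : param G) (z : 'rV[R]_(dimx G k)) : R :=
  cost G k (deviate x z, wpar p k) - dotrow (vpar p k) z.

Definition nash_equilibrium (R : realType) (G : NEP R) (p : param G)
    (x : strat G) : Prop :=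
  forall k : 'I_(nplayers G),
    feasible p (xblock x k) /\
    forall z : 'rV[R]_(dimx G k), feasible p z ->
      objective x p (xblock x k) <= objective x p z.

Definition lagrangian (R : realType) (G : NEP R) (k : 'I_(nplayers G))
    (lk : 'rV[R]_(dimu G k)) (wk : 'rV[R]_(dimw G k)) (x : strat G) : R :=
  cost G k (x, wk) + \sum_i lk 0 i * constr G k i (xblock x k, wk).

Definition S_KKT (R : realType) (G : NEP R) (p : param G)
    : set (strat G * mult G)%type :=
  [set xl | forall k : 'I_(nplayers G),
    let x := xl.1 in
    let lk := lblock xl.2 k in
    vpar p k = xblock (grad (lagrangian lk (wpar p k)) x) k /\
    forall i : 'I_(dimu G k),
      let gi := constr G k i (xblock x k, wpar p k) in
      let ui := upar p k 0 i in
      if (i < neqc G k)%N then gi = ui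
      else [/\ 0 <= lk 0 i, gi <= ui & lk 0 i * (gi - ui) = 0]].

Definition convex_assumptions (R : realType) (G : NEP R) : Prop :=
  forall (k : 'I_(nplayers G)) (w : 'rV[R]_(dimw G k)),
    (forall x : strat G,
       convex_function setT
         (fun z : 'rV[R]_(dimx G k) => cost G k (deviate x z, w))) /\
    (forall i : 'I_(dimu G k),
       if (i < neqc G k)%N then affine_fun (fun z => constr G k i (z, w))
       else convex_function setT
              (fun z : 'rV[R]_(dimx G k) => constr G k i (z, w))).

Definition gradg (R : realType) (G : NEP R) (p : param G) (x : strat G)
    (k : 'I_(nplayers G)) (i : 'I_(dimu G k)) : 'rV[R]_(dimx G k) :=
  grad (fun z => constr G k i (z, wpar p k)) (xblock x k).

Definition slack (R : realType) (G : NEP R) (p : param G) (x : strat G)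
    (k : 'I_(nplayers G)) (i : 'I_(dimu G k)) : R :=
  constr G k i (xblock x k, wpar p k) - upar p k 0 i.

Definition I1 (R : realType) (G : NEP R) (p : param G) (x : strat G)
    (l : mult G) (k : 'I_(nplayers G)) : {set 'I_(dimu G k)} :=
  [set i : 'I_(dimu G k) | (i < neqc G k)%N
           || ((0 < lblock l k 0 i) && (slack p x i == 0))]%SET.

Definition I2 (R : realType) (G : NEP R) (p : param G) (x : strat G)
    (l : mult G) (k : 'I_(nplayers G)) : {set 'I_(dimu G k)} :=
  [set i : 'I_(dimu G k) |
    [&& (neqc G k <= i)%N, lblock l k 0 i == 0 & slack p x i == 0]]%SET.

Definition SMFCQ (R : realType) (G : NEP R) (p : param G) (x : strat G)
    (l : mult G) (k : 'I_(nplayers G)) : Prop :=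
  free [seq gradg p x i | i in I1 p x l k] /\
  exists z : 'rV[R]_(dimx G k),
    (forall i, i \in I1 p x l k -> dotrow (gradg p x i) z = 0) /\
    (forall i, i \in I2 p x l k -> dotrow (gradg p x i) z < 0).

Definition Kcone (R : realType) (G : NEP R) (p : param G) (x : strat G)
    (l : mult G) : set (strat G) :=
  [set y | forall k : 'I_(nplayers G),
    (forall i, i \in I1 p x l k -> dotrow (gradg p x i) (xblock y k) = 0) /\
    (forall i, i \in I2 p x l k -> dotrow (gradg p x i) (xblock y k) <= 0)].

(* The block of second partials d^2 L^k / dx^k_a dx^i_b. *)
Definition hessL (R : realType) (G : NEP R) (p : param G) (x : strat G)
    (l : mult G) (k i : 'I_(nplayers G)) : 'M[R]_(dimx G k, dimx G i) :=
  submxblock (hess (lagrangian (lblock l k) (wpar p k)) x) k i.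

Definition bilin (R : realType) (m n : nat) (a : 'rV[R]_m) (A : 'M[R]_(m, n))
    (b : 'rV[R]_n) : R := (a *m A *m b^T) 0 0.

(* The maximum is taken in the extended reals only to have a neutral element. *)
Definition P_property (R : realType) (G : NEP R) (p : param G) (x : strat G)
    (l : mult G) (K : set (strat G)) : Prop :=
  forall y : strat G, y != 0 -> K y ->
    (0 < \big[maxe/-oo]_(k < nplayers G)
      ((\sum_(i < nplayers G | i != k)
          bilin (xblock y k) (hessL p x l k i) (xblock y i))
       + 2^-1 * bilin (xblock y k) (hessL p x l k k) (xblock y k))%:E)%E.

(* Main.v *)
From HB Require Import structures.
Require Import Defs.
From mathcomp Require Import all_boot all_order all_algebra.
From mathcomp Require Import all_classical all_reals all_analysis.
From mathcomp Require Import ring lra zify.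

(* Write sigma = l - lbar, t = |x - xbar|, e = |p - pbar|.  The KKT system at p
   is a variational inequality in (x, l); truncated to a small box around
   (xbar, lbar) it has a solution for every p, by a Sperner-type argument.
   Every solution of the truncated system at p near pbar is O(e)-close to
   (xbar, lbar), so it lies inside the box and is a KKT point, and nearby KKT
   points are such solutions.  The bound comes in two steps.
   (1) Testing the x-part at xbar + r d, with d opposite in sign to
   sum_i sigma_i grad g_i, and using SMFCQ as an injectivity estimate for this
   sum on the admissible sigma, gives |sigma| = O(t + e).
   (2) By convexity, replacing x^k by xbar^k does not decrease L^k(., l).
   Expanding L^k(., lbar) to second order at (xbar, wbar), this bounds the
   bracket of the P-property at x - xbar above by o(t^2) + O(t e) for every
   player, while x - xbar is o(t) + O(e)-close to the cone K; compactness of the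
   unit sphere then gives t = O(e).
   Finally, under convexity every KKT point is a Nash equilibrium. *)

(** Truncation supplies the compactness for existence. It is harmless because what step (1) and the
    second-order comparison use of complementarity, namely sigma_i * slack_i >= 0 and the vanishing
    of inactive multipliers, survives when a multiplier sits at an artificial bound. The x-part may
    also lie on the boundary of its box, so step (1) tests at the fixed distance r instead of using
    the gradient equation; the price is the requirement e <= eta * r. The factor 1/2 on the own
    block of the P-property appears because step (2) compares two values of L^k that differ only in
    block k: the own block enters through the quadratic Taylor term, the other blocks through a
    mixed difference. Step (1) has to precede step (2): exchanging l for lbar in that comparison
    costs |sigma| * O(e), which is O((t + e) e) once |sigma| = O(t + e). The same bound keeps the
    multipliers of strongly active constraints off their lower bound, and this is what puts x - xbar
    near K. *)

Set Implicit Arguments.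
Unset Strict Implicit.
Unset Printing Implicit Defensive.

Import Order.TTheory GRing.Theory Num.Theory.
Import numFieldNormedType.Exports.

Local Open Scope classical_set_scope.
Local Open Scope ring_scope.

(** * A cubical Kuhn lemma modulo 2 *)

Section CubicalLabelling.
Variables (I : eqType) (P : nat).
Implicit Types (z c : I -> nat) (s : seq I) (a : (I -> nat) -> bool).

Definition step (j : I) z : I -> nat := fun l => (z l + (l == j))%N.
Definition upd z (j : I) (i : nat) : I -> nat := fun l => if l == j then i else z l.

Lemma stepC j l z : step j (step l z) = step l (step j z).
Proof. by apply/funext => m; rewrite /step addnAC. Qed.

Lemma updC z j l i k : j != l -> upd (upd z j i) l k = upd (upd z l k) j i.
Proof.
move=> jl; apply/funext => m; rewrite /upd.
by case: eqP => // ->; rewrite eq_sym (negPf jl).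
Qed.

(* The cup product mod 2 of the coboundaries of the labels in [la], evaluated
   on the cube with lowest vertex [z] and edge directions [s]. *)
Fixpoint cup (la : seq ((I -> nat) -> bool)) s z : bool :=
  if la is a :: la' then
    \sum_(j <- s) (a (step j z) + a z) * cup la' [seq l <- s | l != j] (step j z)
  else 1.

(** Off-diagonal terms cancel in pairs mod 2. In [cup_closed] this expresses that a face of
    codimension two of a cube lies in exactly two facets. *)
Lemma sum_symmetric_bool s (H : I -> I -> bool) :
  (forall j, H j j = 0) -> (forall j l, H j l = H l j) ->
  \sum_(j <- s) \sum_(l <- s) H j l = 0.
Proof.
move=> H0 HC; elim: s => [|x s IH]; first by rewrite big_nil.
rewrite big_cons big_cons H0 add0r.
under [X in _ + X]eq_bigr => j _ do rewrite big_cons HC.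
by rewrite big_split /= IH addr0; exact: addbb.
Qed.

Lemma leibniz_bool (x x' y y' : bool) :
  (x' + x) * y' + x * (y' + y) = x' * y' + x * y.
Proof. by case: x; case: x'; case: y; case: y'. Qed.

(** When the cochain [cup la] is closed, its product with the coboundary of [a] is itself a
    coboundary: a sum over facets, each weighted by [a] at the lowest vertex of the facet. *)
Lemma cup_leibniz a la s z :
  \sum_(l <- s) (cup la [seq m <- s | m != l] (step l z)
                 + cup la [seq m <- s | m != l] z) = 0 ->
  cup (a :: la) s z =
  \sum_(l <- s) (a (step l z) * cup la [seq m <- s | m != l] (step l z)
                 + a z * cup la [seq m <- s | m != l] z).
Proof.
move=> /(congr1 (fun b => a z * b)); rewrite mulr0 mulr_sumr => E.
rewrite /= -[LHS]addr0 -[X in _ + X]E -big_split; apply: eq_bigr => l _ /=.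
exact: leibniz_bool.
Qed.

(** A product of coboundaries is a cocycle. Expanding every facet by [cup_leibniz] leaves terms
    indexed by two distinct directions and symmetric in them. *)
Lemma cup_closed la s z :
  \sum_(j <- s) (cup la [seq l <- s | l != j] (step j z)
                 + cup la [seq l <- s | l != j] z) = 0.
Proof.
elim: la s z => [|a la IH] s z /=.
  by apply: big1 => j _; exact: addbb.
pose f j l y := a y * cup la [seq m <- [seq m <- s | m != j] | m != l] y.
have cupE t y := cup_leibniz a (IH t y).
transitivity (\sum_(j <- s) \sum_(l <- s) (if l != j then
    (f j l (step l (step j z)) + f j l (step j z))
    + (f j l (step l z) + f j l z) else 0)).
  apply: eq_bigr => j _.
  rewrite -[LHS]/(cup (a :: la) _ _ + cup (a :: la) _ _) !cupE -big_split.
  by rewrite big_filter; exact: big_mkcond.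
apply: sum_symmetric_bool => [j|j l]; first by rewrite eqxx.
rewrite eq_sym; case: ifP => // _.
have fC y : f j l y = f l j y.
  rewrite /f -!filter_predI; congr (_ * cup _ _ _).
  by apply: eq_filter => m /=; rewrite andbC.
by rewrite !fC stepC addrACA.
Qed.

Fixpoint boxsum s (F : (I -> nat) -> bool) c : bool :=
  if s is j :: s' then \sum_(i < P) boxsum s' F (upd c j i) else F c.

Lemma eq_boxsum s F F' c :
  (forall z, (forall l, l \notin s -> z l = c l) -> F z = F' z) ->
  boxsum s F c = boxsum s F' c.
Proof.
elim: s c => [|x s IH] c E /=; first by apply: E.
apply: eq_bigr => i _; apply: IH => z Ez; apply: E => l.
by rewrite inE negb_or => /andP[lx ls]; rewrite Ez // /upd (negPf lx).
Qed.

Lemma boxsum0 s c : boxsum s (fun=> 0) c = 0.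
Proof. by elim: s c => //= x s IH c; apply: big1 => i _; exact: IH. Qed.

Lemma boxsumD s F F' c :
  boxsum s (fun z => F z + F' z) c = boxsum s F c + boxsum s F' c.
Proof.
elim: s c => //= x s IH c; rewrite -big_split /=.
by apply: eq_bigr => i _; exact: IH.
Qed.

Lemma boxsum_sum s (t : seq I) (F : I -> (I -> nat) -> bool) c :
  boxsum s (fun z => \sum_(j <- t) F j z) c = \sum_(j <- t) boxsum s (F j) c.
Proof.
elim: t => [|x t IH].
  rewrite big_nil -[RHS](boxsum0 s c); apply: eq_boxsum => z _.
  by rewrite big_nil.
rewrite big_cons -IH -boxsumD; apply: eq_boxsum => z _.
by rewrite big_cons.
Qed.

Lemma boxsum_step s (G : (I -> nat) -> bool) j i c : j \notin s ->
  boxsum s (fun z => G (step j z)) (upd c j i) = boxsum s G (upd c j i.+1).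
Proof.
elim: s c => [|x s IH] c /=.
  move=> _; congr G; apply/funext => l; rewrite /step /upd.
  by case: eqP => _; rewrite (addn0,addn1).
rewrite inE negb_or => /andP[jx js]; apply: eq_bigr => k _.
by rewrite updC // IH // updC // eq_sym.
Qed.

(** Facets shared by neighbouring cubes cancel, and only the two opposite sides of the grid
    orthogonal to [j] remain. *)
Lemma boxsum_telescope s (G : (I -> nat) -> bool) j c : uniq s -> j \in s ->
  boxsum s (fun z => G (step j z) + G z) c =
  boxsum [seq l <- s | l != j] G (upd c j P) +
  boxsum [seq l <- s | l != j] G (upd c j 0).
Proof.
elim: s c => //= x s IH c /andP[xs us]; rewrite inE.
have [-> _|jx /= js] := eqVneq j x.
  rewrite /=; have -> : [seq l <- s | l != x] = s.
    by apply/all_filterP/allP => l ls; apply: contraNneq xs => <-.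
  under eq_bigr => i _ do rewrite boxsumD boxsum_step //.
  elim: {IH}P => [|Q IHQ]; first by rewrite big_ord0; symmetry; exact: addbb.
  by rewrite big_ord_recr /= IHQ; do 3!case: (boxsum s G _).
rewrite /= -big_split /=; apply: eq_bigr => i _.
by rewrite IH // ![upd (upd c j _) _ _]updC.
Qed.

Variable lab : I -> (I -> nat) -> bool.
Hypothesis lab0 : forall j z, z j = 0%N -> lab j z = false.
Hypothesis labP : forall j z, z j = P -> lab j z = true.

(** Along a cube inside a side of the grid orthogonal to [j] the label [j] is constant, so its
    coboundary, a factor of the product, vanishes. *)
Lemma cup_face s (js : seq I) j z : j \in js -> j \notin s ->
  z j = 0%N \/ z j = P -> cup [seq lab i | i <- js] s z = 0.
Proof.
elim: js s z => //= i js IH s z; rewrite inE => jis jns zj.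
rewrite big_seq; apply: big1 => l ls.
have jl : (j == l) = false by apply: contraNF jns => /eqP->.
have zj' : step l z j = z j by rewrite /step jl addn0.
case/orP: jis => [/eqP <-|jjs].
  rewrite [X in X * _](_ : _ = 0) ?mul0r//.
  by case: zj => zj; [rewrite !lab0 ?zj'// | rewrite !labP ?zj'//].
rewrite IH ?mulr0 // ?zj' //.
by rewrite mem_filter (negPf jns) andbF.
Qed.

(** Induction on the dimension. After [cup_leibniz] the sum telescopes to the sides of the grid.
    Sides orthogonal to a direction of the tail vanish by [cup_face]; of the two orthogonal to [x],
    the lower one has weight 0 and the upper one reproduces the sum in one dimension less. *)
Lemma boxsum_cup s c : uniq s ->
  boxsum s (cup [seq lab i | i <- s] s) c = 1.
Proof.
elim: s c => [|x s IH] c //= us; move: (us) => /= /andP[xs us'].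
rewrite -[LHS]/(boxsum (x :: s) (cup [seq lab i | i <- x :: s] (x :: s)) c).
under eq_boxsum => z _ do rewrite [cup _ _ _](cup_leibniz _ (cup_closed _ _ _)).
rewrite boxsum_sum big_cons [X in _ + X](_ : _ = 0).
  have Es : [seq m <- x :: s | m != x] = s.
    by rewrite /= eqxx; apply/all_filterP/allP => l ls; apply: contraNneq xs => <-.
  rewrite addr0 (@boxsum_telescope _ (fun z => lab x z *
     cup [seq lab i | i <- s] [seq m <- x :: s | m != x] z)) ?inE ?eqxx // Es.
  rewrite [X in _ + X](_ : _ = 0) ?addr0.
    rewrite -[RHS](IH (upd c x P) us'); apply: eq_boxsum => z Ez.
    by rewrite labP ?mul1r // Ez // /upd eqxx.
  rewrite -[RHS](boxsum0 s (upd c x 0)); apply: eq_boxsum => z Ez.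
  by rewrite lab0 ?mul0r // Ez // /upd eqxx.
rewrite big_seq; apply: big1 => j js.
have jxs : j \in x :: s by rewrite inE js orbT.
rewrite (@boxsum_telescope _ (fun z => lab x z *
     cup [seq lab i | i <- s] [seq m <- x :: s | m != j] z)) //.
rewrite [X in X + _](_ : _ = 0) ?add0r.
  rewrite -[RHS](boxsum0 [seq m <- x :: s | m != j] (upd c j 0)).
  apply: eq_boxsum => z Ez; rewrite (cup_face js) ?mulr0 ?mem_filter ?eqxx //.
  by left; rewrite Ez ?mem_filter ?eqxx // /upd eqxx.
rewrite -[RHS](boxsum0 [seq m <- x :: s | m != j] (upd c j P)).
apply: eq_boxsum => z Ez; rewrite (cup_face js) ?mulr0 ?mem_filter ?eqxx //.
by right; rewrite Ez ?mem_filter ?eqxx // /upd eqxx.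
Qed.

Lemma boxsum_neq0 s F c : boxsum s F c = 1 ->
  exists z, [/\ F z = 1, (forall j, j \in s -> (z j < P)%N)
    & forall j, j \notin s -> z j = c j].
Proof.
elim: s c => [|x s IH] c /=; first by move=> Fc; exists c.
move=> E; have : exists i : 'I_P, boxsum s F (upd c x i) = 1.
  apply/existsP; apply: contra_eqT E; rewrite negb_exists => /forallP E.
  by rewrite big1 // => i _; apply/negbTE; have := E i; case: boxsum.
move=> [i /IH [z [Fz zs zn]]]; exists z; split => // j; last first.
  by rewrite inE negb_or => /andP[jx js]; rewrite zn // /upd (negPf jx).
rewrite inE => /orP[/eqP ->|/zs //].
have [/zs //|xs] := boolP (x \in s).
by rewrite zn // /upd eqxx.
Qed.

(** A nonzero product contains a path of edges of the cube on which each label in turn changes its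
    value. *)
Lemma cup_neq0 la s z i : cup [seq lab j | j <- la] s z = 1 -> i \in la ->
  exists y y', [/\ lab i y != lab i y', (forall l, (z l <= y l <= z l + (l \in s))%N)
    & (forall l, (z l <= y' l <= z l + (l \in s))%N)].
Proof.
elim: la s z => //= m la IH s z E; rewrite inE => ain.
have : exists2 j, j \in s & (lab m (step j z) + lab m z) *
    cup [seq lab j | j <- la] [seq l <- s | l != j] (step j z) = 1.
  apply/hasP; apply: contra_eqT E => /hasPn E.
  rewrite big_seq big1 // => j /E.
  by case: (_ * _).
move=> [j js /andP[bj cj]].
case/orP: ain => [/eqP ->|ain].
  exists (step j z), z; split.
  - by move: bj; case: (lab m _); case: (lab m _).
  - move=> l; rewrite /step leq_addr leq_add2l /=.
    by case: eqP => // ->; rewrite js.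
  - by move=> l; rewrite leqnn leq_addr.
have [y [y' [E' yz yz']]] := IH _ _ cj ain.
have aux (u : I -> nat) : (forall l, (step j z l <= u l <= step j z l +
    (l \in [seq l <- s | l != j]))%N) ->
    forall l, (z l <= u l <= z l + (l \in s))%N.
  move=> h l; have := h l; rewrite /step mem_filter.
  by case: eqP => [->|_]; rewrite ?js /= ?addn0 //; case/andP => h1 h2; rewrite h2 andbT (leq_trans _ h1) // leq_addr.
by exists y, y'; split => //; exact: aux.
Qed.

(** The total over the grid is odd, so some unit cube carries a nonzero product: a discrete form of
    the Poincare-Miranda theorem. *)
Lemma cubical_labelling s : uniq s -> exists z : I -> nat,
  forall j, j \in s -> (z j < P)%N /\ exists y y',
    [/\ lab j y = false, lab j y' = true,
        (forall l, (z l <= y l <= (z l).+1)%N)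
      & (forall l, (z l <= y' l <= (z l).+1)%N)].
Proof.
move=> us; have [z [Ez zs _]] := boxsum_neq0 (boxsum_cup (fun=> 0%N) us).
exists z => j js; split; first exact: zs.
have [y [y' [E yz yz']]] := cup_neq0 Ez js.
have aux (u : I -> nat) : (forall l, (z l <= u l <= z l + (l \in s))%N) ->
    forall l, (z l <= u l <= (z l).+1)%N.
  move=> h l; have /andP[-> h2] := h l; rewrite (leq_trans h2) //.
  by rewrite -addn1 leq_add2l; case: (_ \in _).
case yj : (lab j y).
  by exists y', y; split => //; [apply/negbTE; rewrite yj eq_sym in E; move: E; case: (lab j y') |exact: aux|exact: aux].
by exists y, y'; split => //; [rewrite yj in E; move: E; case: (lab j y')|exact: aux|exact: aux].
Qed.

End CubicalLabelling.

(** * Variational inequalities on boxes *)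

Section RowNorm.
Variables (R : realType) (n : nat).
Implicit Types x y : 'rV[R]_n.

Lemma row_norm_coord x j : `|x 0 j| <= `|x|.
Proof.
rewrite [leRHS]/Num.norm /= mx_normrE; apply/bigmax_geP; right.
by exists (0, j).
Qed.

Lemma row_norm_le x c : 0 <= c -> (forall j, `|x 0 j| <= c) -> `|x| <= c.
Proof.
move=> c0 xc; rewrite [leLHS]/Num.norm /= mx_normrE; apply/bigmax_leP; split => //.
by move=> [i j] _ /=; rewrite ord1.
Qed.

End RowNorm.

(** Grid points are labelled by the signs of the components of [F]. Ever finer cubes that carry both
    values of every label cluster at a point [x], and there continuity turns the two labels into the
    two sign conditions. *)
Lemma box_variational_inequality (R : realType) d (F : 'I_d -> 'rV[R]_d -> R)
    (lo hi : 'rV[R]_d) : (forall j, continuous (F j)) -> (forall j, lo 0 j < hi 0 j) ->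
  exists w : 'rV[R]_d, forall j,
    [/\ lo 0 j <= w 0 j <= hi 0 j, w 0 j < hi 0 j -> 0 <= F j w
      & lo 0 j < w 0 j -> F j w <= 0].
Proof.
move=> Fc lohi.
(* Clamping with [minn] keeps the point in the box for every index. *)
pose pt n (z : 'I_d -> nat) : 'rV[R]_d :=
  \row_j (lo 0 j + (minn (z j) n.+1)%:R / n.+1%:R * (hi 0 j - lo 0 j)).
(* The sign of [F j], overridden on the two sides of the grid orthogonal to [j] to meet the boundary
   conditions of the labelling lemma. *)
pose lab n (j : 'I_d) (z : 'I_d -> nat) :=
  (0 < z j)%N && ((n < z j)%N || (0 < F j (pt n z))).
have /choice[z Hz] n : exists z : 'I_d -> nat, forall j, (z j < n.+1)%N /\
  exists y y', [/\ lab n j y = false, lab n j y' = true,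
        (forall l, (z l <= y l <= (z l).+1)%N)
      & (forall l, (z l <= y' l <= (z l).+1)%N)].
  have [//|//|z Hz] := @cubical_labelling _ n.+1 (lab n) _ _ (enum 'I_d) (enum_uniq _).
  - by move=> j z zj; rewrite /lab zj.
  - by move=> j z zj; rewrite /lab zj ltnS leqnn.
  by exists z => j; apply: Hz; rewrite mem_enum.
pose w n := pt n (z n).
have ptbox n y j : lo 0 j <= pt n y 0 j <= hi 0 j.
  rewrite mxE; have := lohi j.
  set q := _ / _; have q0 : 0 <= q by rewrite divr_ge0.
  have q1 : q <= 1 by rewrite ler_pdivrMr ?ltr0n // mul1r ler_nat geq_minr.
  by move=> ?; apply/andP; split; nra.
have cpt := @rV_compact R d (fun j => `[lo 0 j, hi 0 j]%classic) (fun j => @segment_compact _ _ _).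
have [//|x [xbox xcl]] := cpt (w @ \oo) _ _.
  by exists 0%N => // n _ j; rewrite /= in_itv /=; exact: (ptbox n (z n) j).
exists x => j.
set D := `|hi - lo|.
(* Around [x] there are arbitrarily fine grid points carrying both labels. *)
have key (B : set 'rV[R]_d) : nbhs x B -> exists n y y',
    [/\ lab n j y = false, lab n j y' = true, B (pt n y) & B (pt n y')].
  move=> /nbhs_ballP[e /= e0 Be].
  have D1 : 0 < D + 1 by rewrite ltr_wpDl ?normr_ge0.
  (* A mesh for which a unit cube has diameter at most [e / 2]; the divisor [D + 1] is positive even
     when [D] is 0. *)
  have e20 : 0 < e / 2 / (D + 1) by apply: divr_gt0 => //; exact: divr_gt0.
  have [N _ HN] := near_infty_natSinv_lt (PosNum e20).
  have wN : (w @ \oo) [set w n | n in [set n | (N <= n)%N]].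
    by exists N => // n Nn; exists n.
  have [_ [[n Nn <-] xwn]] := xcl _ _ wN (nbhsx_ballx x (e / 2) (divr_gt0 e0 (ltr0Sn _ _))).
  have [znP [y [y' [ly ly' zy zy']]]] := Hz n j.
  have near_w u : (forall l, (z n l <= u l <= (z n l).+1)%N) -> B (pt n u).
    move=> zu; apply: Be; rewrite -ball_normE /ball_ /=.
    rewrite (splitr e) -(subrK (w n) x) -addrA.
    apply: (le_lt_trans (ler_normD _ _)); apply: ltr_leD.
      by move: xwn; rewrite -ball_normE.
    apply: row_norm_le => [|l]; first by rewrite divr_ge0 // ltW.
    rewrite !mxE.
    set a := minn _ _; set b := minn _ _.
    have ab : `|a%:R - b%:R| <= 1 :> R.
      have [/andP[h1 h2]|/andP[h1 h2]] : (a <= b <= a.+1)%N \/ (b <= a <= b.+1)%N.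
      - by have := zu l; rewrite /a /b; lia.
      - by rewrite distrC ger0_norm ?subr_ge0 ?ler_nat// lerBlDl natr1 ler_nat.
      - by rewrite ger0_norm ?subr_ge0 ?ler_nat// lerBlDl natr1 ler_nat.
    have -> : lo 0 l + a%:R / n.+1%:R * (hi 0 l - lo 0 l) -
      (lo 0 l + b%:R / n.+1%:R * (hi 0 l - lo 0 l)) =
      (a%:R - b%:R) * (n.+1%:R^-1 * (hi - lo) 0 l) by rewrite !mxE; ring.
    rewrite normrM -[leRHS]mul1r; apply: ler_pM => //.
    rewrite normrM ger0_norm ?invr_ge0//.
    have := HN n Nn => /= Hn.
    have Dl := row_norm_coord (hi - lo) l; rewrite -/D in Dl.
    apply: (@le_trans _ _ (e / 2 / (D + 1) * (D + 1))); last by rewrite divfK // gt_eqF.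
    apply: ler_pM => //; first exact: ltW.
    by rewrite (le_trans Dl) // lerDl.
  by exists n, y, y'; split => //; exact: near_w.
have [xlo xhi] : lo 0 j <= x 0 j /\ x 0 j <= hi 0 j by apply/andP; have := xbox j; rewrite /= in_itv.
have Fjc : F j v @[v --> x] --> F j x.
  exact: Fc.
split; first by rewrite xlo.
(* A vertex labelled true lies on the upper side or has [F j] positive, and both are excluded near
   [x]. The other sign condition is symmetric. *)
- move=> xjhi; rewrite leNgt; apply/negP => Fneg.
  have [|n [y [y' [_ ly' _ [h1 h2]]]]] := key [set v : 'rV[R]_d | v 0 j < hi 0 j /\ F j v < 0].
    apply: filterI; first exact: (cvgr_lt _ (@coord_continuous _ _ _ 0 j x) _ xjhi).
    exact: (cvgr_lt _ Fjc _ Fneg).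
  move: ly' => /andP[_ /orP[ny|]]; last by rewrite ltNge ltW.
  by move: h1; rewrite mxE (minn_idPr _) // divff ?mul1r ?subrKC ?ltxx// pnatr_eq0.
- move=> xjlo; rewrite leNgt; apply/negP => Fpos.
  have [|n [y [y' [ly _ [h1 h2] _]]]] := key [set v : 'rV[R]_d | lo 0 j < v 0 j /\ 0 < F j v].
    apply: filterI; first exact: (cvgr_gt _ (@coord_continuous _ _ _ 0 j x) _ xjlo).
    exact: (cvgr_gt _ Fjc _ Fpos).
  move: ly; rewrite /lab h2 orbT andbT => /negbT; rewrite -leqNgt leqn0 => /eqP y0.
  by move: h1; rewrite mxE y0 min0n !mul0r addr0 ltxx.
Qed.

(** * Second-order expansions *)

Lemma fin_lower_bound (R : realType) (I : finType) (d : I -> R) :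
  (forall i, 0 < d i) -> exists2 d0 : R, 0 < d0 & forall i, d0 <= d i.
Proof.
move=> d0; exists (\big[Num.min/1]_i d i); last first.
  by move=> i; exact: bigmin_le_cond.
by apply/bigmin_gtP; split.
Qed.

Lemma fin_upper_bound (R : realType) (I : finType) (C : I -> R) :
  exists2 C0 : R, 0 < C0 & forall i, C i <= C0.
Proof.
exists (\big[Num.max/1]_i C i); last by move=> i; exact: le_bigmax.
by apply/bigmax_gtP; left.
Qed.

Section Differential.
Variables (R : realType) (E : normedModType R).
Implicit Types (F : E -> R) (z a b h : E).

Lemma deriveDl F z a b : differentiable F z ->
  'D_(a + b) F z = 'D_a F z + 'D_b F z.
Proof. by move=> dF; rewrite !deriveE // linearD. Qed.

Lemma deriveZl F z (c : R) a : differentiable F z ->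
  'D_(c *: a) F z = c * 'D_a F z.
Proof. by move=> dF; rewrite !deriveE // linearZ. Qed.

Lemma derive_suml F z (I : finType) (c : I -> R) (e : I -> E) :
  differentiable F z ->
  'D_(\sum_i c i *: e i) F z = \sum_i c i * 'D_(e i) F z.
Proof.
by move=> dF; rewrite deriveE // linear_sum; apply: eq_bigr => i _; rewrite linearZ /= deriveE.
Qed.

Lemma differentiable_sum_seq (I : Type) (r : seq I) (G : I -> E -> R) z :
  (forall i, differentiable (G i) z) ->
  differentiable (fun y => \sum_(i <- r) G i y) z /\
  forall v, 'D_v (fun y => \sum_(i <- r) G i y) z = \sum_(i <- r) 'D_v (G i) z.
Proof.
move=> dG; elim: r => [|i r [IH1 IH2]].
  have -> : (fun y => \sum_(i <- [::]) G i y) = cst 0 by apply/funext => y; rewrite big_nil.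
  by split=> [|v]; [exact: differentiable_cst | rewrite big_nil derive_cst].
have -> : (fun y => \sum_(i <- i :: r) G i y) = G i + (fun y => \sum_(i <- r) G i y).
  by apply/funext => y; rewrite big_cons.
split=> [|v]; first exact: differentiableD.
by rewrite big_cons deriveD -?IH2 //; exact: diff_derivable.
Qed.

Lemma differentiable_approx F z (eps : R) : differentiable F z -> 0 < eps ->
  exists2 d : R, 0 < d & forall h, `|h| <= d ->
    `|F (z + h) - F z - 'D_h F z| <= eps * `|h|.
Proof.
move=> dF eps0.
have /funext/eqaddoP/(_ eps eps0) := diff_locallyx dF.
move=> /nbhs_ballP[d /= d0 Hd]; exists (d / 2); first by rewrite divr_gt0.
move=> h hd; have := Hd h; rewrite -ball_normE /ball_ /= sub0r normrN.
rewrite !fctE (addrC h z) deriveE // opprD addrA; apply.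
by rewrite (le_lt_trans hd) // gtr_pMr // invf_lt1 // ltr1n.
Qed.

Lemma derive_bounded F z : differentiable F z ->
  exists2 C : R, 0 < C & forall h, `|'D_h F z| <= C * `|h|.
Proof.
move=> dF; have [C C0 HC] := linear_lipschitz (diff_continuous dF).
by exists C => // h; rewrite deriveE.
Qed.

Lemma is_derive_line F z b (s : R) : (forall y, differentiable F y) ->
  is_derive s (1 : R) (fun s : R => F (z + s *: b)) ('D_b F (z + s *: b)).
Proof.
move=> dF.
have E' : (fun h : R => h^-1 *: (F (z + (h *: (1 : R) + s) *: b) - F (z + s *: b)))
    = (fun h : R => h^-1 *: (F (h *: b + (z + s *: b)) - F (z + s *: b))).
  apply/funext => h; congr (_ *: (F _ - _)).
  by rewrite [h *: 1]mulr1 scalerDl addrCA.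
have := @diff_derivable _ _ _ F (z + s *: b) b (dF _); rewrite /derivable => D.
by split; [rewrite /derivable /= E' | rewrite /derive /= E'].
Qed.

(** Convexity is assumed along one segment, since the Lagrangian is convex in the player's own block
    and not jointly. *)
Lemma derive_le_convex F z v : derivable F z v ->
  (forall t : R, 0 <= t <= 1 -> F (z + t *: v) <= (1 - t) * F z + t * F (z + v)) ->
  'D_v F z <= F (z + v) - F z.
Proof.
move=> dF cF; rewrite leNgt; apply/negP => lt.
have /(cvgr_gt _)/(_ _ lt) : h^-1 *: (F (h *: v + z) - F z) @[h --> (0 : R)^'] --> 'D_v F z by exact: dF.
move=> /nbhs_ballP[d /= d0 Hd].
pose h := Num.min (d / 2) 1.
have h0 : 0 < h by rewrite lt_min ltr01 divr_gt0.
have := Hd h; rewrite -ball_normE /ball_ /= sub0r normrN gtr0_norm //.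
have hd : h < d by rewrite gt_min; apply/orP; left; rewrite gtr_pMr // invf_lt1 // ltr1n.
move=> /(_ hd); rewrite gt_eqF // => /(_ isT).
apply/negP; rewrite -leNgt -[leLHS]/(h^-1 * (F (h *: v + z) - F z)).
rewrite ler_pdivrMl // lerBlDr (addrC _ z).
have h1 : 0 <= h <= 1 by rewrite ltW //= ge_min lexx orbT.
by apply: (le_trans (cF _ h1)); lra.
Qed.

End Differential.

(** In [taylor2], [FA], [FB], [FC], [FD] are the values of F at z + a + b, z + b, z + a and z. [P]
    and [Q] are the derivatives along b produced by the mean value theorem for the mixed difference,
    [N] their reference value; [T] is the derivative along a produced for the pure increment. *)
Lemma taylor2_arith (R : realType) (FA FB FC FD P Q T Da Dab S W N t e a b a1 b1 c1 : R) :
  FA - FB - (FC - FD) = P - Q -> FC - FD - 2^-1 * W = T - t * W ->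
  `|P - N - (Dab + S)| <= e / 3 * c1 * b ->
  `|Q - N - S| <= e / 3 * b1 * b -> `|T - Da - t * W| <= e / 3 * a1 * a ->
  0 <= e -> 0 <= a -> 0 <= b -> a1 <= a -> b1 <= b -> c1 <= a + b ->
  `|FA - FB - Da - Dab - 2^-1 * W| <= e * (a + b) ^+ 2.
Proof.
move=> Es Et H1 H2 H3 e0 a0 b0 ha hb hc.
have -> : FA - FB - Da - Dab - 2^-1 * W =
  (P - N - (Dab + S)) - (Q - N - S) + (T - Da - t * W) by move: Es Et; lra.
apply: (le_trans (ler_normD _ _)).
apply: (le_trans (lerD (ler_normB _ _) (lexx _))).
apply: (le_trans (lerD (lerD H1 H2) H3)).
have e3 : 0 <= e / 3 by rewrite divr_ge0.
have -> : e * (a + b) ^+ 2 = e / 3 * (a + b) * (a + b) + e / 3 * (a + b) * (a + b)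
   + e / 3 * (a + b) * (a + b) by field.
by rewrite -!mulrA; do !apply: lerD; apply: ler_wpM2l => //; nra.
Qed.

Lemma derive2_sumr (R : realType) (E : normedModType R) (F : E -> R) z h
    (I : finType) (c : I -> R) (e : I -> E) : Cdiff 2 F ->
  'D_h (fun y => 'D_(\sum_i c i *: e i) F y) z =
  \sum_i c i * 'D_h (fun y => 'D_(e i) F y) z.
Proof.
move=> [dF ddF].
have -> : (fun y => 'D_(\sum_i c i *: e i) F y) = (fun y => \sum_i c i * 'D_(e i) F y).
  by apply/funext => y; rewrite derive_suml.
have D i : differentiable (fun y => 'D_(e i) F y) z by have [] := ddF (e i).
have D' i : differentiable (fun y => c i * 'D_(e i) F y) z by exact: differentiableZ.
have [_ ->] := differentiable_sum_seq (index_enum I) D'.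
by apply: eq_bigr => i _; rewrite deriveZ //; exact: diff_derivable.
Qed.

Lemma derive2_addr (R : realType) (E : normedModType R) (F : E -> R) z h b b' :
  Cdiff 2 F -> 'D_h (fun y => 'D_(b + b') F y) z =
  'D_h (fun y => 'D_b F y) z + 'D_h (fun y => 'D_b' F y) z.
Proof.
move=> [dF ddF].
have -> : (fun y => 'D_(b + b') F y) = (fun y => 'D_b F y) + (fun y => 'D_b' F y).
  by apply/funext => y; rewrite deriveDl.
by rewrite deriveD //; apply: diff_derivable; [case: (ddF b) | case: (ddF b')].
Qed.

(** * Second-order estimates uniform in the direction *)

Section Taylor.
Variables (R : realType) (E : normedModType R).
Variables (J : finType) (e : J -> E) (c : J -> E -> R).
Hypothesis frameE : forall b, b = \sum_j c j b *: e j.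
Hypothesis frame_le : forall j b, `|c j b| <= `|b|.
Variables (F : E -> R) (z : E).
Hypothesis F2 : Cdiff 2 F.

Let dF y : differentiable F y. Proof. by case: F2. Qed.
Let ddF v y : differentiable (fun x => 'D_v F x) y.
Proof. by case: F2 => _ /(_ v)[]. Qed.

Lemma derive2_suml h (b : E) :
  'D_h (fun y => 'D_b F y) z = \sum_j c j b * 'D_h (fun y => 'D_(e j) F y) z.
Proof. by rewrite {1}(frameE b) derive2_sumr. Qed.

(** Differentiability gives the estimate for each fixed [b]. Expanding [b] in the frame reduces it
    to finitely many directions and makes it uniform; the frame stands for finite dimension. *)
Lemma derive2_approx (eps : R) : 0 < eps ->
  exists2 d : R, 0 < d & forall h b, `|h| <= d ->
    `|'D_b F (z + h) - 'D_b F z - 'D_h (fun y => 'D_b F y) z| <= eps * `|h| * `|b|.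
Proof.
move=> eps0; pose eps' := eps / (#|J|%:R + 1).
have J1 : 0 < #|J|%:R + 1 :> R by rewrite ltr_wpDl.
have e0 : 0 < eps' by rewrite divr_gt0.
have /choice[d Hd] j : exists d : R, 0 < d /\ forall h, `|h| <= d ->
    `|'D_(e j) F (z + h) - 'D_(e j) F z - 'D_h (fun y => 'D_(e j) F y) z| <= eps' * `|h|.
  by have [d d0 Hd] := differentiable_approx (ddF (e j) z) e0; exists d.
have [d0 d00 Hd0] : exists2 d0 : R, 0 < d0 & forall j, d0 <= d j.
  exact: fin_lower_bound (fun j => (Hd j).1).
exists d0 => // h b hd.
have DE y : 'D_b F y = \sum_j c j b * 'D_(e j) F y by rewrite {1}(frameE b) derive_suml.
rewrite derive2_suml !DE -!sumrB; apply: (le_trans (ler_norm_sum _ _ _)).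
apply: (@le_trans _ _ (\sum_(j : J) eps' * `|h| * `|b|)).
  apply: ler_sum => j _; rewrite -!mulrBr normrM mulrC; apply: ler_pM => //.
  by apply: (Hd j).2; rewrite (le_trans hd).
rewrite sumr_const -mulr_natl !mulrA; apply: ler_wpM2r => //; apply: ler_wpM2r => //.
by rewrite /eps' ler_pdivrMr // mulrC ler_pM2l // lerDl.
Qed.

Lemma derive2_bounded : exists2 C : R, 0 < C & forall h b,
  `|'D_h (fun y => 'D_b F y) z| <= C * `|h| * `|b|.
Proof.
have /choice[C HC] j : exists C : R, forall h, `|'D_h (fun y => 'D_(e j) F y) z| <= C * `|h|.
  by have [C _ HC] := derive_bounded (ddF (e j) z); exists C.
have [C0 C00 HC0] := fin_upper_bound C.
have J1 : 0 < #|J|%:R + 1 :> R by rewrite ltr_wpDl.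
exists ((#|J|%:R + 1) * C0) => [|h b]; first by rewrite mulr_gt0.
rewrite derive2_suml; apply: (le_trans (ler_norm_sum _ _ _)).
apply: (@le_trans _ _ (\sum_(j : J) C0 * `|h| * `|b|)).
  apply: ler_sum => j _; rewrite normrM mulrC; apply: ler_pM => //.
  by rewrite (le_trans (HC j h)) // ler_wpM2r.
rewrite sumr_const -[leLHS]mulr_natl !mulrA; do 3!apply: ler_wpM2r => //; first exact: ltW.
by rewrite lerDl.
Qed.

Lemma derive_lipschitz : exists2 C : R, 0 < C & exists2 d : R, 0 < d &
  forall h b, `|h| <= d -> `|'D_b F (z + h) - 'D_b F z| <= C * `|h| * `|b|.
Proof.
have [C C0 HC] := derive2_bounded.
have [d d0 Hd] := derive2_approx ltr01.
exists (1 + C); first by rewrite addr_gt0.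
exists d => // h b hd.
rewrite -(subrK ('D_h (fun y => 'D_b F y) z) (_ - _)) (le_trans (ler_normD _ _)) //.
by rewrite !mulrDl lerD // Hd.
Qed.

(** The increment along [a] is expanded at a base point displaced by [b]. The mixed second
    derivative comes out with [a] as outer and [b] as inner direction, the order used by [hess]. *)
Lemma taylor2 (eps : R) : 0 < eps ->
  exists2 d : R, 0 < d & forall a b, `|a| <= d -> `|b| <= d ->
    `|F (z + a + b) - F (z + b) - 'D_a F z - 'D_a (fun y => 'D_b F y) z
      - 2^-1 * 'D_a (fun y => 'D_a F y) z| <= eps * (`|a| + `|b|) ^+ 2.
Proof.
move=> eps0; have e3 : 0 < eps / 3 by rewrite divr_gt0.
have [d d0 Hd] := derive2_approx e3.
exists (d / 2); first by rewrite divr_gt0.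
move=> a b ad bd.
have small (s : R) v : 0 <= s <= 1 -> `|s *: v| <= `|v|.
  by move=> /andP[s0 s1]; rewrite normrZ ger0_norm // ler_piMl.
have [s s01 Es] : exists2 s, 0 <= s <= 1 &
    F (z + a + b) - F (z + b) - (F (z + a) - F z) =
    'D_b F (z + (a + s *: b)) - 'D_b F (z + s *: b).
  (* The mixed difference is g 1 - g 0, so its mean value is taken along [b]. *)
  pose g (s : R) := F (z + a + s *: b) - F (z + s *: b).
  have dg s : is_derive s (1 : R) g ('D_b F (z + a + s *: b) - 'D_b F (z + s *: b)).
    by apply: is_deriveB; exact: is_derive_line.
  have [|s] := MVT ltr01 (fun s _ => dg s).
    by apply: derivable_within_continuous => s _; exact: (@ex_derive _ _ _ _ _ _ _ (dg s)).
  rewrite in_itv /= => /andP[s0 s1]; rewrite /g !scale0r !scale1r !addr0 subr0 mulr1 => ->.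
  by exists s; rewrite ?ltW //= addrA.
have [t t01 Et] : exists2 t, 0 <= t <= 1 &
    F (z + a) - F z - 2^-1 * 'D_a (fun y => 'D_a F y) z =
    'D_a F (z + t *: a) - t * 'D_a (fun y => 'D_a F y) z.
  set D := 'D_a (fun y => 'D_a F y) z.
  (* Subtracting the quadratic term beforehand makes the mean value theorem return a first-order
     error for the derivative of F along [a]. *)
  pose g (s : R) := F (z + s *: a) - 2^-1 * D * (s * s).
  have dg (t : R) : is_derive t (1 : R) g ('D_a F (z + t *: a) - t * D).
    have dq : is_derive t (1 : R) (fun s : R => 2^-1 * D * (s * s)) (t * D).
      have -> : (fun s : R => 2^-1 * D * (s * s)) = (2^-1 * D) \*: (fun s : R => s ^+ 2).
        by apply/funext => s'; rewrite /= expr2.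
      apply: is_derive_eq.
      by rewrite -[LHS]/(2^-1 * D * (t * 1 + t * 1)); field.
    exact: (@is_deriveB _ _ _ _ _ _ _ _ _ (is_derive_line z a t dF) dq).
  have [|t] := MVT ltr01 (fun t _ => dg t).
    by apply: derivable_within_continuous => t _; exact: (@ex_derive _ _ _ _ _ _ _ (dg t)).
  rewrite in_itv /= => /andP[t0 t1]; rewrite /g scale0r scale1r addr0 subr0 !mulr1 !mulr0 subr0 => Eg.
  by exists t; rewrite ?ltW //= -Eg addrAC.
have ha : `|s *: b| <= `|b| by exact: small.
have hb : `|t *: a| <= `|a| by exact: small.
have hc : `|a + s *: b| <= `|a| + `|b| by rewrite (le_trans (ler_normD _ _)) // lerD2l.
have d2 : d / 2 <= d by rewrite ler_pdivrMr // ler_peMr ?ler1n // ltW.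
have H1 : `|_| <= _ := Hd (a + s *: b) b (le_trans hc (le_trans (lerD ad bd) _)).
have {H1}H1 := H1 _; rewrite -splitr lexx in H1; have {H1}H1 := H1 isT.
have H2 : `|_| <= _ := Hd (s *: b) b (le_trans ha (le_trans bd d2)).
have H3 : `|_| <= _ := Hd (t *: a) a (le_trans hb (le_trans ad d2)).
rewrite deriveDl // in H1.
rewrite [X in _ - X]deriveZl // in H3.
have a0 := normr_ge0 a; have b0 := normr_ge0 b.
exact: (taylor2_arith Es Et H1 H2 H3 (ltW eps0)).
Qed.

End Taylor.

(** * Continuity of sums and a compactness gap on the unit sphere *)

Lemma continuous_sum (R : realType) (T : topologicalType) (I : Type) (r : seq I)
    (G : I -> T -> R) :
  (forall i, continuous (G i)) -> continuous (fun y => \sum_(i <- r) G i y).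
Proof.
move=> Gc; elim: r => [|i r IH] y.
  have -> : (fun y => \sum_(i <- [::]) G i y) = cst 0.
    by apply/funext => t; rewrite big_nil.
  exact: cvg_cst.
have -> : (fun y => \sum_(i <- i :: r) G i y) = G i + (fun y => \sum_(i <- r) G i y).
  by apply/funext => t; rewrite big_cons.
by apply: (@cvgD _ R); [exact: Gc | exact: IH].
Qed.

Lemma continuous_mul (R : realType) (T : topologicalType) (f g : T -> R) :
  continuous f -> continuous g -> continuous (fun y => f y * g y).
Proof. by move=> fc gc y; apply: (@cvgM R); [exact: fc | exact: gc]. Qed.

Lemma continuous_add (R : realType) (T : topologicalType) (f g : T -> R) :
  continuous f -> continuous g -> continuous (fun y => f y + g y).
Proof. by move=> fc gc y; apply: (@cvgD _ R); [exact: fc | exact: gc]. Qed.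

Lemma continuous_abs (R : realType) (T : topologicalType) (f : T -> R) :
  continuous f -> continuous (fun y => `|f y|).
Proof. by move=> fc y; apply: cvg_norm; exact: fc. Qed.

(** The sum of the positive parts is continuous and has a positive minimum on the sphere. The lemma
    turns SMFCQ and the P-property into quantitative estimates. *)
Lemma sphere_gap (R : realType) n (I : finType) (h : I -> 'rV[R]_n -> R) :
  (forall i, continuous (h i)) ->
  (forall y, `|y| = 1 -> exists i, 0 < h i y) ->
  exists2 c : R, 0 < c & forall y, `|y| = 1 -> exists i, c <= h i y.
Proof.
move=> hc hpos; pose S := [set y : 'rV[R]_n | `|y| = 1].
(* In dimension 0 the sphere is empty and any constant serves. *)
have [S0|S0] := pselect (S !=set0); last first.
  by exists 1 => // y y1; exfalso; apply: S0; exists y.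
have cptS : compact S.
  apply: bounded_closed_compact.
    exists 1; split => // M M1 y /= ->; exact: ltW.
  have -> : S = (fun y : 'rV[R]_n => `|y|) @^-1` [set 1] by [].
  by apply: closed_comp => [y _|]; [exact: norm_continuous | exact: closed_eq].
pose m y := \sum_i Num.max (h i y) 0.
have mc : continuous m.
  apply: continuous_sum => i y.
  by apply: (@continuous_max R _ (h i) (cst 0)); [exact: hc | exact: cst_continuous].
have [y0 /set_mem y01 y0min] := compact_EVT_min S0 cptS (continuous_subspaceT mc).
have m0 : 0 < m y0.
  have [i hi] := hpos _ y01.
  rewrite /m (bigD1 i) //= ltr_pwDl ?lt_max ?hi //.
  by apply: sumr_ge0 => j _; rewrite le_max lexx orbT.
have J1 : 0 < #|I|%:R + 1 :> R by rewrite ltr_wpDl.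
(* If every [h i y] were below [c], the sum of positive parts would be at most #|I| * c, which is
   less than its minimum. *)
pose c := m y0 / (#|I|%:R + 1).
have c0 : 0 < c by rewrite divr_gt0.
exists c => // y y1; apply: contrapT => /forallNP H.
have : m y <= \sum_(i : I) c.
  apply: ler_sum => i _; rewrite ge_max ltW //= ?ltW //.
  by rewrite ltNge; exact/negP/H.
apply/negP; rewrite -ltNge sumr_const -mulr_natl.
rewrite (@lt_le_trans _ _ (m y0)) //; last by apply: y0min; exact/mem_set.
by rewrite mulrA ltr_pdivrMr // mulrC ltr_pM2l // ltrDl.
Qed.

(** * Calculus for the class C^j *)

Section MoreDiff.
Variables (R : realType).

(* The hypothesis says that [A] is affine along the line through [x]. *)
Lemma derive_affine_comp (D E : normedModType R) (A : D -> E) (F : E -> R) x v a :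
  (forall h : R, A (h *: v + x) = h *: a + A x) ->
  'D_v (F \o A) x = 'D_a F (A x).
Proof.
move=> HA.
have E' : (fun h : R => h^-1 *: ((F \o A) (h *: v + x) - (F \o A) x)) =
   (fun h : R => h^-1 *: (F (h *: a + A x) - F (A x))).
  by apply/funext => h /=; rewrite HA.
by rewrite /derive /= E'.
Qed.

(** A directional derivative of the composite is again a derivative of [F], in the image direction,
    composed with [L]; hence the induction on [j]. *)
Lemma Cdiff_comp (D E : normedModType R) (L : {linear D -> E}) j (F : E -> R) :
  continuous L -> Cdiff j F -> Cdiff j (F \o L).
Proof.
move=> Lc; elim: j F => [|j IH] F /=; first by move=> Fc x; exact: (continuous_comp (Lc x) (Fc _)).
move=> [dF CF]; split=> [x|v].
  by apply: differentiable_comp => //; exact: linear_differentiable.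
have -> : (fun x => 'D_v (F \o L) x) = (fun y => 'D_(L v) F y) \o L.
  by apply/funext => x; apply: derive_affine_comp => h; rewrite linearP.
exact: IH.
Qed.

Lemma Cdiff_add (E : normedModType R) j (F F' : E -> R) :
  Cdiff j F -> Cdiff j F' -> Cdiff j (fun x => F x + F' x).
Proof.
elim: j F F' => [|j IH] F F' /=.
  by move=> Fc Fc' x; apply: (@cvgD _ R); [exact: Fc | exact: Fc'].
move=> [dF CF] [dF' CF']; split=> [x|v]; first exact: differentiableD.
have -> : (fun x => 'D_v (fun x => F x + F' x) x) = (fun x => 'D_v F x + 'D_v F' x).
  by apply/funext => x; rewrite -deriveD //; exact: diff_derivable.
exact: IH.
Qed.

Lemma Cdiff_scale (E : normedModType R) j c (F : E -> R) :
  Cdiff j F -> Cdiff j (fun x => c * F x).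
Proof.
elim: j F => [|j IH] F /=.
  by move=> Fc x; apply: (@cvgM R); [exact: cvg_cst | exact: Fc].
move=> [dF CF]; split=> [x|v]; first exact: differentiableZ.
have -> : (fun x => 'D_v (fun x => c * F x) x) = (fun x => c * 'D_v F x).
  by apply/funext => x; apply: (@deriveZ _ _ R); exact: diff_derivable.
exact: IH.
Qed.

Lemma Cdiff0 (E : normedModType R) j : Cdiff j (fun _ : E => 0 : R).
Proof.
elim: j => [|j IH] /=; first exact: cst_continuous.
split=> [x|v]; first exact: differentiable_cst.
by have -> : (fun x : E => 'D_v (fun=> 0 : R) x) = (fun=> 0) by apply/funext => x; rewrite derive_cst.
Qed.

Lemma Cdiff_sum (E : normedModType R) (I : Type) (r : seq I) j (F : I -> E -> R) :
  (forall i, Cdiff j (F i)) -> Cdiff j (fun x => \sum_(i <- r) F i x).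
Proof.
move=> CF; elim: r => [|i r IH].
  have -> : (fun x => \sum_(i <- [::]) F i x) = (fun=> 0).
    by apply/funext => t; rewrite big_nil.
  exact: Cdiff0.
have -> : (fun x => \sum_(i <- i :: r) F i x) = (fun x => F i x + \sum_(i <- r) F i x).
  by apply/funext => t; rewrite big_cons.
exact: Cdiff_add.
Qed.

Lemma Cdiff_continuous (E : normedModType R) j (F : E -> R) : Cdiff j F -> continuous F.
Proof. by case: j => [//|j] [dF _] x; exact: differentiable_continuous. Qed.

End MoreDiff.

(** * Coordinates on pairs, dot products and blocks *)

Section PairFrame.
Variables (R : realType) (n d : nat).

(** The standard basis of R^n * R^d; with [pair_coord] it is the frame on which the Taylor estimates
    are run for the joint variable (x, w). *)
Definition pair_frame (j : 'I_n + 'I_d) : 'rV[R]_n * 'rV[R]_d :=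
  match j with inl a => (delta_mx 0 a, 0) | inr b => (0, delta_mx 0 b) end.

Definition pair_coord (j : 'I_n + 'I_d) (z : 'rV[R]_n * 'rV[R]_d) : R :=
  match j with inl a => z.1 0 a | inr b => z.2 0 b end.

Lemma pair_frameE z : z = \sum_j pair_coord j z *: pair_frame j.
Proof.
case: z => x w; rewrite big_sumType /=.
have Ex : \sum_(a < n) x 0 a *: ((delta_mx 0 a : 'rV[R]_n), (0 : 'rV[R]_d)) = (x, 0).
  rewrite {2}(row_sum_delta x).
  elim/big_rec2: _ => [//|i y1 y2 _ ->]; congr (_, _).
  by rewrite /= scaler0 addr0.
have Ew : \sum_(a < d) w 0 a *: ((0 : 'rV[R]_n), (delta_mx 0 a : 'rV[R]_d)) = (0, w).
  rewrite {2}(row_sum_delta w).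
  elim/big_rec2: _ => [//|i y1 y2 _ ->]; congr (_, _).
  by rewrite /= scaler0 addr0.
by rewrite Ex Ew; congr (_, _); rewrite /= ?addr0 ?add0r.
Qed.

Lemma pair_coord_le j z : `|pair_coord j z| <= `|z|.
Proof.
rewrite prod_normE le_max; case: j => [a|b] /=; rewrite row_norm_coord ?orbT //.
Qed.

Lemma pair_norm_le (z : 'rV[R]_n * 'rV[R]_d) c : `|z.1| <= c -> `|z.2| <= c -> `|z| <= c.
Proof. by rewrite prod_normE ge_max => -> ->. Qed.

End PairFrame.

Section Dot.
Variables (R : realType) (n : nat).
Implicit Types a b : 'rV[R]_n.

Lemma dotrowE a b : dotrow a b = \sum_i a 0 i * b 0 i.
Proof. by rewrite /dotrow mxE; apply: eq_bigr => i _; rewrite mxE. Qed.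

Lemma dotrowDr a b c : dotrow a (b + c) = dotrow a b + dotrow a c.
Proof. by rewrite /dotrow linearD mulmxDr mxE. Qed.

Lemma dotrowZr a t b : dotrow a (t *: b) = t * dotrow a b.
Proof. by rewrite /dotrow linearZ /= -scalemxAr mxE. Qed.

Lemma dotrowNr a b : dotrow a (- b) = - dotrow a b.
Proof. by rewrite -scaleN1r dotrowZr mulN1r. Qed.

Lemma dotrowBr a b c : dotrow a (b - c) = dotrow a b - dotrow a c.
Proof. by rewrite dotrowDr dotrowNr. Qed.

Lemma dotrowBl a b c : dotrow (a - b) c = dotrow a c - dotrow b c.
Proof. by rewrite /dotrow mulmxBl !mxE. Qed.

Lemma dotrow_suml (I : finType) (c : I -> R) (a : I -> 'rV[R]_n) b :
  dotrow (\sum_i c i *: a i) b = \sum_i c i * dotrow (a i) b.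
Proof.
rewrite /dotrow mulmx_suml summxE; apply: eq_bigr => i _.
by rewrite -scalemxAl mxE.
Qed.

Lemma dotrow_norm a b : `|dotrow a b| <= n%:R * `|a| * `|b|.
Proof.
rewrite dotrowE; apply: (le_trans (ler_norm_sum _ _ _)).
apply: (@le_trans _ _ (\sum_(i < n) `|a| * `|b|)).
  by apply: ler_sum => i _; rewrite normrM; apply: ler_pM => //; exact: row_norm_coord.
by rewrite sumr_const card_ord -[leLHS]mulr_natl mulrA.
Qed.

Lemma dotrow_grad (F : 'rV[R]_n -> R) x h : differentiable F x ->
  dotrow (grad F x) h = 'D_h F x.
Proof.
move=> dF; rewrite [in RHS](row_sum_delta h) derive_suml // dotrowE.
by apply: eq_bigr => i _; rewrite mxE mulrC.
Qed.

Lemma dotrow_delta a i : dotrow a (delta_mx 0 i) = a 0 i.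
Proof.
rewrite dotrowE (bigD1 i) //= mxE !eqxx mulr1 big1 ?addr0 // => j ji.
by rewrite mxE (negPf ji) andbF mulr0.
Qed.

Lemma dotrow_inj a b : (forall h, dotrow a h = dotrow b h) -> a = b.
Proof. by move=> E; apply/rowP => i; rewrite -!dotrow_delta. Qed.

End Dot.

Section Blocks.
Variables (R : realType) (q : nat) (n : 'I_q -> nat).
Implicit Types x y : 'rV[R]_(\sum_j n j).

Lemma submxrow_norm x k : `|submxrow x k| <= `|x|.
Proof. by apply: row_norm_le => // j; rewrite mxE row_norm_coord. Qed.

Lemma mxrow_norm_le x c : 0 <= c -> (forall k, `|submxrow x k| <= c) -> `|x| <= c.
Proof.
move=> c0 xc; apply: row_norm_le => // j.
rewrite -(tagnat.sig2K j); have := row_norm_coord (submxrow x (tagnat.sig1 j)) (tagnat.sig2 j).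
by rewrite mxE => /le_trans; apply.
Qed.

Lemma mxrow_Rank (B : forall k, 'rV[R]_(n k)) k a :
  (\mxrow_j B j) 0 (tagnat.Rank k a) = B k 0 a.
Proof. by have /rowP/(_ a) := mxrowK B k; rewrite mxE. Qed.

Lemma submxrow_linear k : linear (fun x => submxrow x k).
Proof. by move=> a x y; apply/rowP => j; rewrite !mxE. Qed.
Variable d : nat.

Definition block_pair k (z : 'rV[R]_(\sum_j n j) * 'rV[R]_d) : 'rV[R]_(n k) * 'rV[R]_d :=
  (submxrow z.1 k, z.2).

Lemma block_pair_linear k : linear (block_pair k).
Proof.
move=> a [x u] [y v]; rewrite /block_pair /=; congr (_, _).
by rewrite -[RHS]submxrow_linear.
Qed.
HB.instance Definition _ k :=
  GRing.isLinear.Build R _ _ _ (block_pair k) (block_pair_linear k).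

Lemma block_pair_continuous k : continuous (block_pair k).
Proof.
apply/linear_bounded_continuous/linear_boundedP.
exists 1; split => // C C1 x; apply: (@le_trans _ _ `|x|).
  apply: pair_norm_le; rewrite ?(le_trans (submxrow_norm _ _)) // prod_normE le_max lexx ?orbT //.
by rewrite ler_peMl // ltW.
Qed.

End Blocks.

(** * Unilateral displacements *)

Section Game.
Variables (R : realType) (G : NEP R).
Notation N := (nplayers G).
Implicit Types (x y : strat G) (k : 'I_N).

(** Makes a unilateral deviation a translation ([deviateE]), to which directional derivatives
    apply. *)
Definition emb k (h : 'rV[R]_(dimx G k)) : strat G := deviate 0 h.

Lemma xblock_deviate x k (z : 'rV[R]_(dimx G k)) : xblock (deviate x z) k = z.
Proof. by rewrite /xblock /deviate mxrowK dfwithin. Qed.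

Lemma xblock_deviate_neq x k (z : 'rV[R]_(dimx G k)) j : k != j -> xblock (deviate x z) j = xblock x j.
Proof. by move=> kj; rewrite /xblock /deviate mxrowK dfwithout. Qed.

Lemma xblock_emb k (h : 'rV[R]_(dimx G k)) : xblock (emb h) k = h.
Proof. exact: xblock_deviate. Qed.

Lemma xblock_emb_neq k (h : 'rV[R]_(dimx G k)) j : k != j -> xblock (emb h) j = 0.
Proof. by move=> kj; rewrite xblock_deviate_neq // /xblock submxrow0. Qed.

Lemma stratP x y : (forall j, xblock x j = xblock y j) -> x = y.
Proof. by move=> E; apply/mxrowP. Qed.

Lemma xblockD x y j : xblock (x + y) j = xblock x j + xblock y j.
Proof. exact: submxrowD. Qed.
Lemma xblockB x y j : xblock (x - y) j = xblock x j - xblock y j.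
Proof. exact: submxrowB. Qed.
Lemma xblockN x j : xblock (- x) j = - xblock x j.
Proof. exact: submxrowN. Qed.
Lemma xblockZ c x j : xblock (c *: x) j = c *: xblock x j.
Proof. by apply/rowP => i; rewrite !mxE. Qed.

Lemma deviateE x k (z : 'rV[R]_(dimx G k)) : deviate x z = x + emb (z - xblock x k).
Proof.
apply: stratP => j; rewrite xblockD; have [<-|kj] := eqVneq k j.
  by rewrite xblock_deviate xblock_emb addrC subrK.
by rewrite xblock_deviate_neq // xblock_emb_neq // addr0.
Qed.

Lemma emb_linear k : linear (@emb k).
Proof.
move=> a h h'; apply: stratP => j; rewrite xblockD xblockZ.
have [<-|kj] := eqVneq k j; first by rewrite !xblock_emb.
by rewrite !xblock_emb_neq // scaler0 addr0.
Qed.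
HB.instance Definition _ k :=
  GRing.isLinear.Build R _ _ _ (@emb k) (@emb_linear k).

Lemma emb_norm k h : `|@emb k h| <= `|h|.
Proof.
apply: mxrow_norm_le => // j; rewrite -/(xblock _ j).
have [<-|kj] := eqVneq k j; first by rewrite xblock_emb.
by rewrite xblock_emb_neq // normr0.
Qed.

Lemma emb_delta k a : emb (delta_mx 0 a : 'rV[R]_(dimx G k)) = delta_mx 0 (tagnat.Rank k a).
Proof.
apply: stratP => j; have [<-|kj] := eqVneq k j.
  rewrite xblock_emb; apply/rowP => b; rewrite !mxE /=.
  by rewrite -[tagnat.Rank k b == _](inj_eq val_inj) /= tagnat.eq_Rank eqxx.
rewrite xblock_emb_neq //; apply/rowP => b; rewrite !mxE /=.
by rewrite -(inj_eq val_inj) tagnat.eq_Rank eq_sym (negPf kj).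
Qed.

End Game.

(** * The Lagrangians of the players *)

Lemma pair0_affine (R : realType) (V W : normedModType R) (t : R) (v x : V) (w : W) :
  (t *: v + x, w) = t *: (v, 0) + (x, w).
Proof. by rewrite -[RHS]/(t *: v + x, t *: 0 + w) scaler0 add0r. Qed.

Lemma pair0_sum (R : realType) (V W : normedModType R) n (c : 'I_n -> R) (e : 'I_n -> V) :
  \sum_a c a *: (e a, 0 : W) = (\sum_a c a *: e a, 0).
Proof.
elim/big_rec2: _ => [//|i y1 y2 _ ->].
by rewrite -[LHS]/(c i *: e i + y1, c i *: 0 + 0) scaler0 addr0.
Qed.

Lemma emb_sum (R : realType) (G : NEP R) k (h : 'rV[R]_(dimx G k)) :
  emb h = \sum_a h 0 a *: emb (delta_mx 0 a : 'rV[R]_(dimx G k)).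
Proof.
by rewrite {1}(row_sum_delta h) linear_sum; apply: eq_bigr => a _; rewrite linearZ.
Qed.

Section Lagrangian.
Variables (R : realType) (G : NEP R) (k : 'I_(nplayers G)).
Implicit Types (l : 'rV[R]_(dimu G k)) (w : 'rV[R]_(dimw G k)) (x : strat G)
  (h : 'rV[R]_(dimx G k)).

(* The Lagrangian of player [k] as a function of [x] and [w] jointly. *)
Definition ell l (z : 'rV[R]_(\sum_j dimx G j) * 'rV[R]_(dimw G k)) : R :=
  cost G k z + \sum_i l 0 i * constr G k i (block_pair k z).

Lemma ell_C2 l : Cdiff 2 (ell l).
Proof.
apply: Cdiff_add; first exact: cost_C2.
apply: Cdiff_sum => i; apply: Cdiff_scale.
have C := @Cdiff_comp R _ _ (@block_pair R _ (dimx G) _ k) 2 (constr G k i)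
  (@block_pair_continuous _ _ _ _ k) (@constr_C2 _ G k i).
exact: C.
Qed.

Lemma ell_differentiable l z : differentiable (ell l) z.
Proof. by case: (ell_C2 l). Qed.

Lemma cost_differentiable z : differentiable (cost G k) z.
Proof. by case: (cost_C2 k). Qed.

Lemma constr_differentiable i z : differentiable (@constr _ G k i) z.
Proof. by case: (constr_C2 i). Qed.

Lemma derive_ell l b z : 'D_b (ell l) z =
  'D_b (cost G k) z + \sum_i l 0 i * 'D_(block_pair k b) (constr G k i) (block_pair k z).
Proof.
have D i y : differentiable (fun z => constr G k i (block_pair k z)) y.
  apply: (differentiable_comp (linear_differentiable _ _)); first exact: block_pair_continuous.
  exact: constr_differentiable.
have D' i : differentiable (fun z => l 0 i * constr G k i (block_pair k z)) z.
  exact: differentiableZ.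
have [S1 S2] := differentiable_sum_seq (index_enum 'I_(dimu G k)) D'.
rewrite deriveD; first last.
- exact: diff_derivable.
- by apply: diff_derivable; exact: cost_differentiable.
rewrite S2; congr (_ + _); apply: eq_bigr => i _.
rewrite deriveZ; last exact: diff_derivable.
congr (_ * _); apply: (@derive_affine_comp R _ _ (@block_pair R _ (dimx G) _ k)).
by move=> t; exact: block_pair_linear.
Qed.

Lemma derive_lagrangian l w x b : 'D_b (lagrangian l w) x = 'D_(b, 0) (ell l) (x, w).
Proof.
apply: (@derive_affine_comp _ _ _ (fun x : strat G => (x, w)) (ell l)) => t.
exact: pair0_affine.
Qed.

Lemma dotrow_grad_lagrangian l w x h :
  dotrow (xblock (grad (lagrangian l w) x) k) h = 'D_(emb h, 0) (ell l) (x, w).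
Proof.
have -> : (emb h, 0) = \sum_a h 0 a *: (emb (delta_mx 0 a : 'rV[R]_(dimx G k)),
     (0 : 'rV[R]_(dimw G k))).
  by rewrite pair0_sum -emb_sum.
rewrite derive_suml; last exact: ell_differentiable.
rewrite dotrowE; apply: eq_bigr => a _; rewrite mulrC; congr (_ * _).
by rewrite !mxE derive_lagrangian emb_delta.
Qed.

(** Translates the Hessian blocks of the P-property into the iterated directional derivatives
    delivered by [taylor2]. *)
Lemma hess_block_lagrangian l w x (i : 'I_(nplayers G)) h (h' : 'rV[R]_(dimx G i)) :
  bilin h (submxblock (hess (lagrangian l w) x) k i) h' =
  'D_(emb h, 0) (fun z => 'D_(emb h', 0) (ell l) z) (x, w).
Proof.
have E j (v : 'rV[R]_(dimx G j)) : (emb v, 0) =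
   \sum_a v 0 a *: (emb (delta_mx 0 a : 'rV[R]_(dimx G j)), (0 : 'rV[R]_(dimw G k))).
  by rewrite pair0_sum -emb_sum.
rewrite (E _ h') derive2_sumr; last exact: ell_C2.
rewrite /bilin mxE; apply: eq_bigr => b _; rewrite mulrC !mxE; congr (_ * _).
rewrite (E _ h) derive_suml; last by case: (ell_C2 l) => _ H; case: (H (emb (delta_mx 0 b : 'rV[R]_(dimx G i)), 0)).
apply: eq_bigr => a _; congr (_ * _).
rewrite !mxE; rewrite -!emb_delta.
have -> : (fun y : strat G => 'D_(emb (delta_mx 0 b : 'rV[R]_(dimx G i))) (lagrangian l w) y) =
   (fun z => 'D_(emb (delta_mx 0 b : 'rV[R]_(dimx G i)), 0) (ell l) z) \o (fun x => (x, w)).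
  by apply/funext => y; rewrite derive_lagrangian.
apply: (@derive_affine_comp _ _ _ (fun x : strat G => (x, w))
  (fun z => 'D_(emb (delta_mx 0 b : 'rV[R]_(dimx G i)), 0) (ell l) z)) => t.
exact: pair0_affine.
Qed.

(** The Lagrangian is convex in the player's own block: convex constraints carry nonnegative
    multipliers, and affine ones satisfy the convexity inequality with equality, so their
    multipliers may have any sign. *)
Lemma derive_ell_le l w x h :
  convex_assumptions G ->
  (forall i : 'I_(dimu G k), (neqc G k <= i)%N -> 0 <= l 0 i) ->
  'D_(emb h, 0) (ell l) (x, w) <= ell l (x + emb h, w) - ell l (x, w).
Proof.
move=> /(_ k w)[cf cg] l0.
have -> : (x + emb h, w) = (x, w) + (emb h, 0).
  by rewrite -[RHS]/(x + emb h, w + 0) addr0.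
apply: derive_le_convex; first by apply: diff_derivable; exact: ell_differentiable.
move=> t t01.
have -> : (x, w) + t *: (emb h, 0) = (x + t *: emb h, w).
  by rewrite -[LHS]/(x + t *: emb h, w + t *: 0) scaler0 addr0.
have -> : (x, w) + (emb h, 0) = (x + emb h, w).
  by rewrite -[LHS]/(x + emb h, w + 0) addr0.
have bp (s : R) : block_pair k (x + s *: emb h, w) = (xblock x k + s *: h, w).
  by rewrite /block_pair /= -/(xblock _ _) xblockD xblockZ xblock_emb.
have bp1 : block_pair k (x + emb h, w) = (xblock x k + h, w).
  by have := bp 1; rewrite !scale1r.
have bp0 : block_pair k (x, w) = (xblock x k, w) by [].
have dev (s : R) : x + s *: emb h = deviate x (xblock x k + s *: h).
  by rewrite deviateE (addrAC (xblock x k)) subrr add0r linearZ.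
have [t0 t1] : 0 <= t /\ t <= 1 by apply/andP.
have cvx (F : 'rV[R]_(dimx G k) -> R) z : convex_function setT F ->
   F (z + t *: h) <= (1 - t) * F z + t * F (z + h).
  move=> /(_ (Itv01 t0 t1) (z + h) z (in_setT _) (in_setT _)).
  rewrite convRE -[conv _ _ _]/(t *: (z + h) + (1 - t) *: z).
  rewrite -[unstable.onem _]/(1 - t) -[(Itv01 t0 t1)%:num]/t.
  have -> : t *: (z + h) + (1 - t) *: z = z + t *: h.
    by rewrite scalerDr scalerBl scale1r addrAC subrKC.
  by move=> /le_trans; apply; rewrite addrC.
rewrite /ell mulrDr mulrDr addrACA; apply: lerD.
  have := cvx _ (xblock x k) (cf x).
  rewrite -dev -{2}[h]scale1r -dev scale1r.
  by rewrite -{1}(addr0 (xblock x k)) -(scale0r h) -dev scale0r addr0.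
rewrite !mulr_sumr -big_split; apply: ler_sum => i _ /=.
rewrite bp bp1 bp0; have := cg i; case: ltnP => [ik [a [c ga]]|ik cgi].
  rewrite le_eqVlt; apply/orP; left; apply/eqP.
  by rewrite !ga !dotrowDr dotrowZr; ring.
have := cvx _ (xblock x k) cgi => /(ler_wpM2l (l0 i ik)) /le_trans; apply.
by rewrite mulrDr mulrCA (mulrCA (l 0 i)).
Qed.

End Lagrangian.

(** * KKT points are Nash equilibria *)

Section KKT.
Variables (R : realType) (G : NEP R).

(** By stationarity and convexity x^k minimizes the Lagrangian minus the linear term, while
    complementarity makes the multiplier term at x^k at least as large as at any feasible z. *)
Lemma S_KKT_nash p (x : strat G) (l : mult G) :
  convex_assumptions G -> S_KKT p (x, l) -> nash_equilibrium p x.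
Proof.
move=> hconv hK k.
have [/= hv hg] := hK k.
set lk := lblock l k in hv hg.
split.
  by move=> i; have /= := hg i; case: ifP => // _ [].
move=> z fz.
have l0 (i : 'I_(dimu G k)) : (neqc G k <= i)%N -> 0 <= lk 0 i.
  by move=> ik; have /= := hg i; rewrite ltnNge ik => -[].
have := derive_ell_le (wpar p k) x (z - xblock x k) hconv l0.
rewrite -deviateE -dotrow_grad_lagrangian -hv dotrowBr.
rewrite /objective.
have -> : deviate x (xblock x k) = x by rewrite deviateE subrr linear0 addr0.
rewrite /ell /block_pair /= -!/(xblock _ _) xblock_deviate.
have : \sum_i lk 0 i * constr G k i (z, wpar p k) <=
  \sum_i lk 0 i * constr G k i (xblock x k, wpar p k).
  apply: ler_sum => i _; have /= := hg i; have := fz i; case: ifP => [_ -> ->//|_ fzi [li _]].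
  by rewrite mulrBr => /subr0_eq ->; apply: ler_wpM2l.
by move=> H1 H2; lra.
Qed.

End KKT.

(** * Estimates near the reference point *)

Lemma gradient_arith (R : realType) (a b v S1 S2 S3 : R) :
  a + S1 - v - (S2 - S3) = a - b + (S1 - S2) - (v - (b + S3)).
Proof. by ring. Qed.

Section Local.
Variables (R : realType) (G : NEP R) (pbar : param G) (xbar : strat G) (lbar : mult G).
Hypothesis hKKT : S_KKT pbar (xbar, lbar).
Implicit Types (p : param G) (x : strat G) (l : mult G).

Lemma upar_norm p k : `|upar p k| <= `|p|.
Proof.
apply: (le_trans (submxrow_norm _ _)).
by rewrite prod_normE le_max [X in _ <= X]prod_normE le_max lexx.
Qed.

Lemma vpar_norm p k : `|vpar p k| <= `|p|.
Proof.
apply: (le_trans (submxrow_norm _ _)).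
by rewrite prod_normE le_max [X in _ <= X]prod_normE le_max lexx orbT.
Qed.

Lemma wpar_norm p k : `|wpar p k| <= `|p|.
Proof.
apply: (le_trans (submxrow_norm _ _)).
by rewrite prod_normE le_max lexx orbT.
Qed.

Lemma wparB p p' k : wpar (p - p') k = wpar p k - wpar p' k.
Proof. exact: submxrowB. Qed.
Lemma uparB p p' k : upar (p - p') k = upar p k - upar p' k.
Proof. exact: submxrowB. Qed.
Lemma vparB p p' k : vpar (p - p') k = vpar p k - vpar p' k.
Proof. exact: submxrowB. Qed.

Lemma xblock_norm x k : `|xblock x k| <= `|x|.
Proof. exact: submxrow_norm. Qed.

Section Player.
Variable k : 'I_(nplayers G).

Lemma derive_emb_lagrangian_bar h :
  'D_(emb h, 0) (ell (lblock lbar k)) (xbar, wpar pbar k) = dotrow (vpar pbar k) h.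
Proof. by have [/= -> _] := hKKT k; rewrite dotrow_grad_lagrangian. Qed.

Lemma dotrow_gradg (i : 'I_(dimu G k)) h : dotrow (gradg pbar xbar i) h =
  'D_(h, 0) (constr G k i) (xblock xbar k, wpar pbar k).
Proof.
rewrite /gradg dotrow_grad; last first.
  apply: (@differentiable_comp _ _ _ _ (fun z => (z, wpar pbar k)) (constr G k i)).
    by apply: differentiable_pair => //; exact: differentiable_cst.
  exact: constr_differentiable.
apply: (@derive_affine_comp _ _ _ (fun z => (z, wpar pbar k)) (constr G k i)) => t.
exact: pair0_affine.
Qed.

(** The sum of sigma_i grad g_i from step (1), with the gradients frozen at the reference point. *)
Definition mult_force l : 'rV[R]_(dimx G k) :=
  \sum_i (lblock l k 0 i - lblock lbar k 0 i) *: gradg pbar xbar i.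

Lemma dotrow_mult_force l h : dotrow (mult_force l) h =
  \sum_i (lblock l k 0 i - lblock lbar k 0 i) *
    'D_(h, 0) (constr G k i) (xblock xbar k, wpar pbar k).
Proof.
by rewrite dotrow_suml; apply: eq_bigr => i _; rewrite dotrow_gradg.
Qed.

Lemma emb_pair_norm (h : 'rV[R]_(dimx G k)) : `|(emb h, 0 : 'rV[R]_(dimw G k))| <= `|h|.
Proof. by apply: pair_norm_le; rewrite ?normr0 //; exact: emb_norm. Qed.

Lemma pair_dist p x : `|(x, wpar p k) - (xbar, wpar pbar k)| <= `|x - xbar| + `|p - pbar|.
Proof.
apply: pair_norm_le => /=; first by rewrite lerDl.
by rewrite -wparB (le_trans (wpar_norm _ k)) ?lerDr.
Qed.

Lemma block_dist p x : `|(xblock x k, wpar p k) - (xblock xbar k, wpar pbar k)|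
  <= `|x - xbar| + `|p - pbar|.
Proof.
apply: pair_norm_le => /=; first by rewrite -xblockB (le_trans (xblock_norm _ _)) ?lerDl.
by rewrite -wparB (le_trans (wpar_norm _ k)) ?lerDr.
Qed.

(** Stationarity at the reference point cancels the leading terms, so the residual of stationarity
    at (p, x, l) is the multiplier force up to O(t + e). The bound [M] enters because the constraint
    gradients vary with weights [l]. *)
Lemma lagrangian_gradient_approx (M : R) :
  exists2 C : R, 0 < C & exists2 d : R, 0 < d & forall p x l,
    `|p - pbar| <= d -> `|x - xbar| <= d -> `|l - lbar| <= M -> forall h,
    `|'D_(emb h, 0) (ell (lblock l k)) (x, wpar p k) - dotrow (vpar p k) h
       - dotrow (mult_force l) h| <= C * (`|x - xbar| + `|p - pbar|) * `|h|.
Proof.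
have [Cf Cf0 [df df0 Hf]] := derive_lipschitz (@pair_frameE R _ _) (@pair_coord_le R _ _)
  (xbar, wpar pbar k) (cost_C2 k).
have /choice[Cd Hg] (i : 'I_(dimu G k)) : exists Cd : R * R, 0 < Cd.2 /\
    (forall h b, `|h| <= Cd.2 -> `|'D_b (constr G k i) ((xblock xbar k, wpar pbar k) + h)
      - 'D_b (constr G k i) (xblock xbar k, wpar pbar k)| <= Cd.1 * `|h| * `|b|).
  have [C C0 [d d0 H]] := derive_lipschitz (@pair_frameE R _ _) (@pair_coord_le R _ _)
    (xblock xbar k, wpar pbar k) (@constr_C2 _ G k i).
  by exists (C, d).
have [dg dg0 Hdg] := fin_lower_bound (fun i => (Hg i).1).
have [Cg Cg0 HCg] := fin_upper_bound (fun i => (Cd i).1).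
pose L := `|lbar| + `|M|.
have L0 : 0 <= L by rewrite addr_ge0.
(* The three summands account for the variation of the cost gradient, of the constraint gradients
   and of v. *)
pose C := Cf + (dimu G k)%:R * (L * Cg) + (dimx G k)%:R.
have C0 : 0 < C by rewrite ltr_wpDr // ltr_wpDr // !mulr_ge0 // ltW.
exists C => //; exists (Num.min df dg / 2); first by rewrite divr_gt0 // lt_min df0.
move=> p x l pd xd lM h.
set D := `|x - xbar| + `|p - pbar|.
have D0 : 0 <= D by rewrite addr_ge0.
have Dd : D <= Num.min df dg by rewrite [leRHS]splitr lerD.
set zb := (xbar, wpar pbar k); set z := (x, wpar p k).
set gb := (xblock xbar k, wpar pbar k); set gz := (xblock x k, wpar p k).
have zD : `|z - zb| <= D by exact: pair_dist.
have gD : `|gz - gb| <= D by exact: block_dist.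
have li i : `|lblock l k 0 i| <= L.
  rewrite -(subrK (lblock lbar k 0 i) (lblock l k 0 i)) addrC.
  rewrite (le_trans (ler_normD _ _)) // lerD //.
    by rewrite (le_trans (row_norm_coord _ _)) // submxrow_norm.
  have -> : lblock l k 0 i - lblock lbar k 0 i = lblock (l - lbar) k 0 i by rewrite !mxE.
  rewrite (le_trans (row_norm_coord _ _)) // (le_trans (submxrow_norm _ _)) //.
  by rewrite (le_trans lM) // ler_norm.
(* The stationarity equation at [pbar] has been subtracted here. *)
have -> : 'D_(emb h, 0) (ell (lblock l k)) z - dotrow (vpar p k) h - dotrow (mult_force l) h =
  ('D_(emb h, 0) (cost G k) z - 'D_(emb h, 0) (cost G k) zb)
  + \sum_i lblock l k 0 i * ('D_(h, 0) (constr G k i) gz - 'D_(h, 0) (constr G k i) gb)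
  - dotrow (vpar (p - pbar) k) h.
  rewrite vparB dotrowBl -derive_emb_lagrangian_bar !derive_ell.
  have bE : block_pair k (emb h, 0) = (h, 0 : 'rV[R]_(dimw G k)).
    by rewrite /block_pair /= -/(xblock _ _) xblock_emb.
  rewrite bE -/zb -[block_pair k zb]/gb -[block_pair k z]/gz dotrow_mult_force.
  under [X in _ = _ + X - _]eq_bigr => i _ do rewrite mulrBr.
  under [X in _ - X = _]eq_bigr => i _ do rewrite mulrBl.
  by rewrite !sumrB; exact: gradient_arith.
apply: (@le_trans _ _ (Cf * D * `|h| + (dimu G k)%:R * (L * Cg) * D * `|h|
   + (dimx G k)%:R * D * `|h|)); last by rewrite -!mulrDl.
apply: (le_trans (ler_normB _ _)); apply: lerD; last first.
  rewrite (le_trans (dotrow_norm _ _)) // ler_wpM2r // ler_wpM2l //.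
  by rewrite (le_trans (vpar_norm _ k)) // lerDr.
apply: (le_trans (ler_normD _ _)); apply: lerD.
  have := Hf (z - zb) (emb h, 0); rewrite subrKC.
  have zd : `|z - zb| <= df by rewrite (le_trans zD) // (le_trans Dd) // ge_min lexx.
  move=> /(_ zd) /le_trans; apply; apply: ler_pM => //; first by rewrite mulr_ge0 // ltW.
    by rewrite ler_pM2l.
  exact: emb_pair_norm.
apply: (le_trans (ler_norm_sum _ _ _)).
apply: (@le_trans _ _ (\sum_(i < dimu G k) L * (Cg * D * `|h|))); last first.
  by rewrite sumr_const card_ord -[leLHS]mulr_natl !mulrA.
apply: ler_sum => i _; rewrite normrM; apply: ler_pM => //.
have [di0 Hi] := Hg i; have := Hi (gz - gb) (h, 0); rewrite subrKC.
have zd : `|gz - gb| <= (Cd i).2.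
  by rewrite (le_trans gD) // (le_trans Dd) // ge_min Hdg orbT.
move=> /(_ zd) /le_trans; apply; apply: (@le_trans _ _ (Cg * `|gz - gb| * `|(h, 0 : 'rV[R]_(dimw G k))|)).
  by do 2!apply: ler_wpM2r => //.
apply: ler_pM => //; first by rewrite mulr_ge0 // ltW.
  by rewrite ler_pM2l.
by apply: pair_norm_le; rewrite ?normr0.
Qed.

End Player.
End Local.

(** The weight [eps / 4] fits increments of sizes t and t + e, because (2t + e)^2 / 4 <= (t +
    e)^2. *)
Lemma lagrangian_arith (R : realType) (eps C n t e a b f1 f2 dv dv' dv'' D B B' W : R) :
  `|f1 - f2 - dv'' - D - W| <= eps / 4 * (a + b) ^+ 2 -> 0 <= a -> 0 <= b ->
  a <= t -> b <= t + e ->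
  dv'' = dv' -> D = B + B' ->
  `|B'| <= C * t * e -> `|dv - dv'| <= n * e * t -> 0 <= eps -> 0 <= t -> 0 <= e ->
  `|f1 - f2 - dv - (B + W)| <= eps * (t + e) ^+ 2 + (C + n) * t * e.
Proof.
move=> H1 a0 b0 Ha Hb E1 E2 H2 H3 eps0 t0 e0; rewrite E1 E2 in H1.
have {}H1 : `|f1 - f2 - dv' - (B + B') - W| <= eps / 4 * (t + (t + e)) ^+ 2.
  apply: (le_trans H1); apply: ler_wpM2l; first by rewrite divr_ge0.
  by rewrite ler_sqr ?nnegrE ?addr_ge0 // lerD.
have -> : f1 - f2 - dv - (B + W) = (f1 - f2 - dv' - (B + B') - W) + B' - (dv - dv') by ring.
rewrite (le_trans (ler_normB _ _)) // (le_trans (lerD (ler_normD _ _) H3)) //.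
rewrite (le_trans (lerD (lerD H1 H2) (lexx _))) //.
have -> : (C + n) * t * e = C * t * e + n * e * t by ring.
rewrite [leRHS]addrA; do 2!apply: lerD => //.
rewrite -mulrA ler_wpM2l //.
have -> : 4^-1 * (t + (t + e)) ^+ 2 = (t + 2^-1 * e) ^+ 2 by field.
by rewrite ler_sqr ?nnegrE ?addr_ge0 // ?mulr_ge0 // lerD2l ler_piMl // invf_le1 // ler1n.
Qed.

Lemma slack_arith (R : realType) (gz gb u ub D1 D2 : R) :
  gz - u - (gb - ub) - D1 = (gz - gb - (D1 + D2)) + D2 - (u - ub).
Proof. by ring. Qed.

(** * Slacks, the bracket of the P-property and SMFCQ for one player *)

Section Local.
Variables (R : realType) (G : NEP R) (pbar : param G) (xbar : strat G) (lbar : mult G).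
Hypothesis hKKT : S_KKT pbar (xbar, lbar).
Implicit Types (p : param G) (x : strat G) (l : mult G).

Section Player.
Variable k : 'I_(nplayers G).

Lemma slack_approx (i : 'I_(dimu G k)) (eps : R) : 0 < eps ->
  exists2 C : R, 0 < C & exists2 d : R, 0 < d & forall p x,
    `|p - pbar| <= d -> `|x - xbar| <= d ->
    `|slack p x i - slack pbar xbar i - dotrow (gradg pbar xbar i) (xblock (x - xbar) k)|
    <= eps * `|x - xbar| + C * `|p - pbar|.
Proof.
move=> eps0.
set gb := (xblock xbar k, wpar pbar k).
have [C C0 HC] := derive_bounded (@constr_differentiable _ G k i gb).
have [d d0 Hd] := differentiable_approx (@constr_differentiable _ G k i gb) eps0.
exists (eps + C + 1); first by rewrite !addr_gt0.
exists (d / 2); first by rewrite divr_gt0.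
move=> p x pd xd.
set t := `|x - xbar|; set e := `|p - pbar|.
have e0 : 0 <= e by exact: normr_ge0.
have D0 : t + e <= d by rewrite [leRHS]splitr lerD.
set gz := (xblock x k, wpar p k).
have gD : `|gz - gb| <= t + e by exact: block_dist.
have := Hd (gz - gb) (le_trans gD D0); rewrite subrKC => H1.
have E : gz - gb = (xblock (x - xbar) k, 0) + (0, wpar (p - pbar) k).
  by rewrite xblockB wparB -[RHS]/(_ + 0, 0 + _) addr0 add0r.
have H2 : `|'D_(0, wpar (p - pbar) k) (constr G k i) gb| <= C * e.
  rewrite (le_trans (HC _)) // ler_pM2l //.
  by apply: pair_norm_le; rewrite ?normr0 //; exact: wpar_norm.
have H3 : `|upar (p - pbar) k 0 i| <= e.
  by rewrite (le_trans (row_norm_coord _ _)) //; exact: upar_norm.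
rewrite dotrow_gradg -/gb.
have DE : 'D_(gz - gb) (constr G k i) gb = 'D_(xblock (x - xbar) k, 0) (constr G k i) gb +
    'D_(0, wpar (p - pbar) k) (constr G k i) gb.
  by rewrite E deriveDl //; exact: constr_differentiable.
move: H1; rewrite DE.
have -> : slack p x i = constr G k i gz - upar p k 0 i by [].
have -> : slack pbar xbar i = constr G k i gb - upar pbar k 0 i by [].
have H3' : `|upar p k 0 i - upar pbar k 0 i| <= e.
  by move: H3; rewrite uparB !mxE.
move=> H1.
have {}H1 := le_trans H1 (ler_wpM2l (ltW eps0) gD).
rewrite (slack_arith _ _ _ _ _ ('D_(0, wpar (p - pbar) k) (constr G k i) gb)).
rewrite (le_trans (ler_normB _ _)) //.
apply: (le_trans (lerD (ler_normD _ _) H3')).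
apply: (le_trans (lerD (lerD H1 H2) (lexx _))).
by rewrite mulrDr !mulrDl mul1r !addrA.
Qed.

(* The bracket of the P-property for player [k]. *)
Definition pform (y : strat G) : R :=
  \sum_(i < nplayers G | i != k)
      bilin (xblock y k) (hessL pbar xbar lbar k i) (xblock y i)
  + 2^-1 * bilin (xblock y k) (hessL pbar xbar lbar k k) (xblock y k).

Let B (a b : strat G) : R :=
  'D_(a, 0) (fun z => 'D_(b, 0) (ell (lblock lbar k)) z) (xbar, wpar pbar k).

Lemma sum_emb (y : strat G) : y - emb (xblock y k) =
  \sum_(i < nplayers G | i != k) emb (xblock y i).
Proof.
have xs j (F : 'I_(nplayers G) -> strat G) (P : pred 'I_(nplayers G)) :
    xblock (\sum_(i | P i) F i) j = \sum_(i | P i) xblock (F i) j.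
  exact: submxrow_sum.
apply: stratP => j; rewrite xblockB xs.
have [<-|kj] := eqVneq k j.
  rewrite xblock_emb subrr big1 // => i ik; exact: xblock_emb_neq.
rewrite xblock_emb_neq // subr0 (bigD1 j) 1?eq_sym //= xblock_emb big1 ?addr0 //.
by move=> i /andP[_ ij]; exact: xblock_emb_neq.
Qed.

(** The sum over the other players is one mixed derivative between the own displacement and the
    remaining one, which is the shape produced by [taylor2]. *)
Lemma pformE (y : strat G) : pform y =
  B (emb (xblock y k)) (y - emb (xblock y k))
  + 2^-1 * B (emb (xblock y k)) (emb (xblock y k)).
Proof.
rewrite /pform /hessL hess_block_lagrangian; congr (_ + _).
have -> : B (emb (xblock y k)) (y - emb (xblock y k)) =
  \sum_(i < nplayers G | i != k) B (emb (xblock y k)) (emb (xblock y i)).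
  rewrite sum_emb.
  rewrite /B.
  have -> : (\sum_(i < nplayers G | i != k) emb (xblock y i), 0 : 'rV[R]_(dimw G k)) =
    \sum_(i < nplayers G) (i != k)%:R *: (emb (xblock y i), 0).
    rewrite pair0_sum; congr (_, _); rewrite big_mkcond; apply: eq_bigr => i _.
    by case: ifP => _; rewrite ?scale1r ?scale0r.
  have DS := @derive2_sumr R _ (ell (lblock lbar k)) (xbar, wpar pbar k)
    (emb (xblock y k), 0) _ (fun i => (i != k)%:R)
    (fun i => (emb (xblock y i), 0 : 'rV[R]_(dimw G k))) (ell_C2 _).
  apply: (etrans DS).
  rewrite [RHS]big_mkcond; apply: eq_bigr => i _.
  by case: ifP => _; rewrite ?mul1r ?mul0r.
by apply: eq_bigr => i _; rewrite hess_block_lagrangian.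
Qed.

Lemma pformZ c y : pform (c *: y) = c ^+ 2 * pform y.
Proof.
have bZ m n (a : 'rV[R]_m) (A : 'M[R]_(m, n)) (b : 'rV[R]_n) :
    bilin (c *: a) A (c *: b) = c ^+ 2 * bilin a A b.
  by rewrite /bilin linearZ /= -!scalemxAl -scalemxAr scalerA mxE expr2.
rewrite /pform mulrDr mulr_sumr; congr (_ + _).
  by apply: eq_bigr => i _; rewrite !xblockZ bZ.
by rewrite !xblockZ bZ mulrCA.
Qed.

(** [taylor2] with the own displacement as [a], and the others' displacement together with the
    change of w as [b]. The first-order term is the pairing with vbar by stationarity; the mixed
    derivative in the change of w is O(t e). *)
Lemma lagrangian_diff_approx (eps : R) : 0 < eps ->
  exists2 C : R, 0 < C & exists2 d : R, 0 < d & forall p x,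
    `|p - pbar| <= d -> `|x - xbar| <= d ->
    `|ell (lblock lbar k) (x, wpar p k)
      - ell (lblock lbar k) (deviate x (xblock xbar k), wpar p k)
      - dotrow (vpar p k) (xblock (x - xbar) k) - pform (x - xbar)|
    <= eps * (`|x - xbar| + `|p - pbar|) ^+ 2
       + C * `|x - xbar| * `|p - pbar|.
Proof.
move=> eps0; have eps4 : 0 < eps / 4 by rewrite divr_gt0.
set F := ell (lblock lbar k); set zb := (xbar, wpar pbar k).
have F2 : Cdiff 2 F := ell_C2 _.
have [C C0 HC] := derive2_bounded (@pair_frameE R _ _) (@pair_coord_le R _ _) zb F2.
have [d d0 Hd] := taylor2 (@pair_frameE R _ _) (@pair_coord_le R _ _) zb F2 eps4.
exists (C + (dimx G k)%:R); first by rewrite ltr_wpDr.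
exists (d / 2); first by rewrite divr_gt0.
move=> p x pd xd; set y := x - xbar.
set t := `|y|; set e := `|p - pbar|.
have t0 : 0 <= t by exact: normr_ge0.
have e0 : 0 <= e by exact: normr_ge0.
have D0 : t + e <= d by rewrite [leRHS]splitr lerD.
set a1 := emb (xblock y k); set b1 := y - a1; set dw := wpar (p - pbar) k.
have a1t : `|a1| <= t by rewrite (le_trans (emb_norm _)) // xblock_norm.
have at_ : `|(a1, 0 : 'rV[R]_(dimw G k))| <= t by apply: pair_norm_le; rewrite ?normr0.
have dwe : `|(0 : 'rV[R]_(\sum_j dimx G j), dw)| <= e.
  by apply: pair_norm_le; rewrite ?normr0 //; exact: wpar_norm.
have b1t : `|b1| <= t.
  rewrite /b1 /a1; apply: mxrow_norm_le => // j; rewrite -/(xblock _ j) xblockB.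
  have [<-|kj] := eqVneq k j; first by rewrite xblock_emb subrr normr0.
  by rewrite xblock_emb_neq // subr0 xblock_norm.
have bt : `|(b1, dw)| <= t + e.
  apply: pair_norm_le => /=; first by rewrite (le_trans b1t) // lerDl.
  by rewrite (le_trans (wpar_norm _ _)) // lerDr.
have := Hd (a1, 0) (b1, dw) (le_trans at_ (le_trans _ D0)) (le_trans bt D0).
rewrite lerDl => /(_ e0).
have -> : zb + (a1, 0) + (b1, dw) = (x, wpar p k).
  rewrite -[LHS]/(xbar + a1 + b1, wpar pbar k + 0 + dw) addr0; congr (_, _).
    by rewrite /b1 -addrA subrKC /y subrKC.
  by rewrite /dw wparB subrKC.
have -> : zb + (b1, dw) = (deviate x (xblock xbar k), wpar p k).
  rewrite -[LHS]/(xbar + b1, wpar pbar k + dw); congr (_, _).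
    by rewrite /b1 addrA /y subrKC deviateE -xblockB -(opprB x xbar) xblockN linearN.
  by rewrite /dw wparB subrKC.
have Eb : (b1, dw) = (b1, 0) + (0, dw) by rewrite -[RHS]/(b1 + 0, 0 + dw) addr0 add0r.
rewrite Eb in bt *; move=> H1.
have DA := @derive2_addr R _ F zb (a1, 0) (b1, 0) (0, dw) F2.
have H2 := HC (a1, 0) (0, dw).
have H3 : `|dotrow (vpar (p - pbar) k) (xblock y k)| <= (dimx G k)%:R * e * t.
  apply: (le_trans (dotrow_norm _ _)); apply: ler_pM; rewrite ?mulr_ge0 //.
    by apply: ler_wpM2l => //; exact: vpar_norm.
  exact: xblock_norm.
rewrite pformE -/a1 -/b1.
move: H3; rewrite vparB dotrowBl => H3.
have {}H2 : `|'D_(a1, 0) (fun z => 'D_(0, dw) F z) zb| <= C * t * e.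
  apply: (le_trans H2); rewrite -!mulrA ler_pM2l //.
  by apply: ler_pM.
exact: (lagrangian_arith H1 (normr_ge0 _) (normr_ge0 _) at_ bt (derive_emb_lagrangian_bar hKKT _) DA H2 H3 (ltW eps0) t0 e0).
Qed.

Lemma continuous_pform : continuous pform.
Proof.
have bc i (H : 'M[R]_(dimx G k, dimx G i)) : continuous (fun y : strat G => bilin (xblock y k) H (xblock y i)).
  have -> : (fun y : strat G => bilin (xblock y k) H (xblock y i)) =
    (fun y => \sum_b (\sum_a y 0 (tagnat.Rank k a) * H a b) * y 0 (tagnat.Rank i b)).
    apply/funext => y; rewrite /bilin mxE; apply: eq_bigr => b _; rewrite !mxE; congr (_ * _).
    by apply: eq_bigr => a _; rewrite !mxE.
  apply: continuous_sum => b; apply: continuous_mul; last exact: coord_continuous.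
  apply: continuous_sum => a; apply: continuous_mul; first exact: coord_continuous.
  exact: cst_continuous.
have c1 : continuous (fun y : strat G => \sum_(i < nplayers G | i != k)
    bilin (xblock y k) (hessL pbar xbar lbar k i) (xblock y i)).
  have -> : (fun y : strat G => \sum_(i < nplayers G | i != k)
      bilin (xblock y k) (hessL pbar xbar lbar k i) (xblock y i)) =
    (fun y => \sum_(i <- [seq i <- index_enum 'I_(nplayers G) | i != k])
      bilin (xblock y k) (hessL pbar xbar lbar k i) (xblock y i)).
    by apply/funext => z; rewrite big_filter.
  by apply: continuous_sum => i; exact: bc.
apply: continuous_add; first exact: c1.
by apply: continuous_mul; [exact: cst_continuous | exact: bc].
Qed.

(** If an admissible [s] gives a zero sum, pairing with the vector [z] of SMFCQ kills its components
    in I2, and linear independence those in I1. Compactness and homogeneity make this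
    quantitative. *)
Lemma smfcq_bound : SMFCQ pbar xbar lbar k ->
  exists2 c : R, 0 < c & forall s : 'rV[R]_(dimu G k),
    (forall i, i \notin I1 pbar xbar lbar k -> i \notin I2 pbar xbar lbar k -> s 0 i = 0) ->
    (forall i, i \in I2 pbar xbar lbar k -> 0 <= s 0 i) ->
    c * `|s| <= \sum_a `|(\sum_i s 0 i *: gradg pbar xbar i) 0 a|.
Proof.
move=> [fr [z [z1 z2]]].
set J1 := I1 pbar xbar lbar k; set J2 := I2 pbar xbar lbar k.
pose f (i : 'I_(dimu G k)) := gradg pbar xbar i.
(* [None] measures the sum, [Some i] the violation of the condition on [s 0 i], so that the
   restricted claim becomes a choice among finitely many functions for [sphere_gap]. *)
pose h (o : option 'I_(dimu G k)) (s : 'rV[R]_(dimu G k)) : R :=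
  if o is Some i then
    if i \in J1 then 0 else if i \in J2 then - s 0 i else `|s 0 i|
  else \sum_a `|(\sum_i s 0 i *: f i) 0 a|.
have hc o : continuous (h o).
  case: o => [i|]; rewrite /h.
    case: (i \in J1); first exact: cst_continuous.
    case: (i \in J2); last by apply: continuous_abs; exact: coord_continuous.
    have -> : (fun s : 'rV[R]_(dimu G k) => - s 0 i) = (fun s => -1 * s 0 i).
      by apply/funext => s; rewrite mulN1r.
    by apply: continuous_mul; [exact: cst_continuous | exact: coord_continuous].
  apply: continuous_sum => a; apply: continuous_abs.
  have -> : (fun s : 'rV[R]_(dimu G k) => (\sum_i s 0 i *: f i) 0 a) = (fun s => \sum_i s 0 i * f i 0 a).
    by apply/funext => s; rewrite summxE; apply: eq_bigr => i _; rewrite mxE.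
  apply: continuous_sum => i; apply: continuous_mul; first exact: coord_continuous.
  exact: cst_continuous.
have hpos s : `|s| = 1 -> exists o, 0 < h o s.
  move=> s1; apply: contrapT => /forallNP H.
  have {}H o : h o s <= 0 by rewrite leNgt; exact/negP/H.
  have sN i : i \notin J1 -> i \notin J2 -> s 0 i = 0.
    move=> i1 i2; have := H (Some i); rewrite /h (negPf i1) (negPf i2) normr_le0 => /eqP //.
  have s2 i : i \notin J1 -> i \in J2 -> 0 <= s 0 i.
    by move=> i1 i2; have := H (Some i); rewrite /h (negPf i1) i2 oppr_le0.
  have S0 : \sum_i s 0 i *: f i = 0.
    apply/rowP => a; rewrite [RHS]mxE; apply/eqP; rewrite -normr_le0 (le_trans _ (H None)) //.
    by rewrite /h (bigD1 a) //= lerDl sumr_ge0.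
  have s2' i : i \notin J1 -> s 0 i = 0.
    move=> i1; have [i2|] := boolP (i \in J2); last exact: sN.
    (* All terms of this zero sum are nonpositive, hence each vanishes. *)
    have : dotrow (\sum_i s 0 i *: f i) z = 0 by rewrite S0 /dotrow mul0mx mxE.
    rewrite dotrow_suml.
    have le0 j : s 0 j * dotrow (f j) z <= 0.
      have [j1|j1] := boolP (j \in J1); first by rewrite z1 // mulr0.
      have [j2|j2] := boolP (j \in J2); last by rewrite sN // mul0r.
      by rewrite mulr_ge0_le0 ?s2 // ltW // z2.
    move=> /eqP; rewrite -oppr_eq0 -sumrN psumr_eq0; last by move=> j _; rewrite oppr_ge0.
    move=> /allP/(_ i (mem_index_enum _)) /=; rewrite oppr_eq0 mulf_eq0.
    by rewrite (lt_eqF (z2 i i2)) orbF => /eqP.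
  have /freeP Fr : free [tuple of [seq f i | i in J1]] by [].
  have E0 : \sum_(j < #|J1|) s 0 (enum_val j) *: [tuple of [seq f i | i in J1]]`_j = 0.
    rewrite -[RHS]S0 [RHS](bigID (mem J1)) /= [X in _ + X]big1 ?addr0; last first.
      by move=> i i1; rewrite s2' // scale0r.
    rewrite [RHS]big_enum_val; apply: eq_bigr => j _; congr (_ *: _).
    by rewrite (nth_image 0).
  have s0 : s = 0.
    apply/rowP => i; rewrite mxE; have [i1|] := boolP (i \in J1); last exact: s2'.
    by have := Fr _ E0 (enum_rank_in i1 i); rewrite enum_rankK_in.
  by move: s1; rewrite s0 normr0 => /eqP; rewrite eq_sym oner_eq0.
have [c c0 Hc] := sphere_gap hc hpos.
exists c => // s sN s2.
have [->|sn0] := eqVneq s 0; first by rewrite normr0 mulr0 sumr_ge0.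
have ns0 : 0 < `|s| by rewrite normr_gt0.
have y1 : `| `|s|^-1 *: s| = 1 by rewrite normrZ normfV normr_id mulVf // gt_eqF.
have [[i|] /=] := Hc _ y1.
  have si : 0 <= `|s|^-1 by rewrite invr_ge0.
  case: ifPn => i1; first by rewrite leNgt c0.
  case: ifPn => i2; rewrite mxE.
    move=> /(lt_le_trans c0); rewrite oppr_gt0 ltNge mulr_ge0 // s2 //.
  by rewrite sN // mulr0 normr0 leNgt c0.
have -> : \sum_a `|(\sum_i (`|s|^-1 *: s) 0 i *: f i) 0 a| =
    `|s|^-1 * \sum_a `|(\sum_i s 0 i *: f i) 0 a|.
  rewrite mulr_sumr; apply: eq_bigr => a _.
  have -> : (\sum_i (`|s|^-1 *: s) 0 i *: f i) 0 a = `|s|^-1 * (\sum_i s 0 i *: f i) 0 a.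
    by rewrite !summxE mulr_sumr; apply: eq_bigr => i _; rewrite !mxE mulrA.
  by rewrite normrM ger0_norm ?invr_ge0.
by rewrite mulrC ler_pdivlMr.
Qed.

End Player.
End Local.

(** * The truncated KKT system *)

(** Since t <= r, the terms carrying [s] on the right amount to at most half of r * c * s. The rest
    is at most 2 * C1 * (t + e) * r, and r cancels. *)
Lemma mult_bound_arith (R : realType) (c m eps C1 C2 r t e s n1 : R) :
  0 < c -> 0 <= m -> m * eps <= c / 4 -> 0 < C1 -> 0 < C2 -> 0 < r -> 0 <= t <= r -> 0 <= e -> 0 <= s ->
  m * C2 * e <= c / 4 * r -> c * s <= n1 -> 0 <= eps ->
  r * n1 <= s * (m * (eps * t + C2 * e)) + C1 * (t + e) * (r + t) ->
  s <= 4 * C1 / c * (t + e).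
Proof.
move=> c0 m0 meps C10 C20 r0 /andP[t0 tr] e0 s0 mC2 cs eps0 H.
have H1 : r * (c * s) <= s * (c / 4 * r + c / 4 * r) + C1 * (t + e) * (r + r).
  apply: (le_trans (ler_wpM2l (ltW r0) cs)); apply: (le_trans H).
  apply: lerD; last first.
    by apply: ler_wpM2l; [rewrite mulr_ge0 ?addr_ge0 // ltW | rewrite lerD2l].
  apply: ler_wpM2l => //; rewrite mulrDr; apply: lerD; last by rewrite mulrA.
  rewrite mulrA; apply: ler_pM => //; exact: mulr_ge0.
have H2 : r * (c * s / 2) <= r * (2 * C1 * (t + e)) by nra.
rewrite ler_pM2l // in H2.
have -> : 4 * C1 / c * (t + e) = (2 * C1 * (t + e)) * 2 / c by field; rewrite gt_eqF.
by rewrite ler_pdivlMr // (mulrC s) -ler_pdivrMr.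
Qed.

Lemma force_arith (R : realType) (A V n B : R) : A - V - n <= B -> V <= A -> 0 <= n + B.
Proof. by lra. Qed.

Section Local.
Variables (R : realType) (G : NEP R) (pbar : param G) (xbar : strat G) (lbar : mult G).
Hypothesis hKKT : S_KKT pbar (xbar, lbar).
Hypothesis hconv : convex_assumptions G.
Implicit Types (p : param G) (x : strat G) (l : mult G).

Definition mult_lo k (i : 'I_(dimu G k)) : R :=
  if (i < neqc G k)%N then lblock lbar k 0 i - 1 else 0.
Definition mult_hi k (i : 'I_(dimu G k)) : R := lblock lbar k 0 i + 1.

(* The KKT system as a variational inequality truncated to a box around
   [(xbar, lbar)]; the lower bound 0 for inequality multipliers is genuine. *)
Record box_solution (r : R) p x l : Prop := BoxSolution {
  box_x : `|x - xbar| <= r;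
  box_vi : forall k (z : 'rV[R]_(dimx G k)), `|z - xblock xbar k| <= r ->
    dotrow (vpar p k) (z - xblock x k) <=
    'D_(emb (z - xblock x k), 0) (ell (lblock l k)) (x, wpar p k);
  box_l : forall k i, mult_lo i <= lblock l k 0 i <= @mult_hi k i;
  box_slack_le : forall k i, lblock l k 0 i < @mult_hi k i -> slack p x i <= 0;
  box_slack_ge : forall k i, @mult_lo k i < lblock l k 0 i -> 0 <= slack p x i
}.

Lemma lbar_ge0 k (i : 'I_(dimu G k)) : (neqc G k <= i)%N -> 0 <= lblock lbar k 0 i.
Proof. by move=> ik; have [_ /(_ i)] /= := hKKT k; rewrite ltnNge ik => -[]. Qed.

Lemma slack_bar_cases k (i : 'I_(dimu G k)) :
  [\/ i \in I1 pbar xbar lbar k /\ slack pbar xbar i = 0,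
      i \in I2 pbar xbar lbar k /\ slack pbar xbar i = 0
    | [/\ (neqc G k <= i)%N, lblock lbar k 0 i = 0 & slack pbar xbar i < 0]].
Proof.
have [_ /(_ i)] /= := hKKT k; rewrite !inE; case: ltnP => ik /=.
  by rewrite /slack => ->; rewrite subrr; apply: Or31.
move=> [l0 sle cs].
have [s0|sn0] := eqVneq (slack pbar xbar i) 0.
  move: l0; rewrite le_eqVlt => /orP[/eqP l0|l0].
    by apply: Or32; rewrite -l0 eqxx.
  by apply: Or31; rewrite l0.
apply: Or33; split => //; last by rewrite lt_neqAle sn0 /slack subr_le0.
by move/eqP: cs; rewrite mulf_eq0 (negPf sn0) orbF => /eqP.
Qed.

Lemma mult_lo_le k (i : 'I_(dimu G k)) : mult_lo i <= lblock lbar k 0 i.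
Proof. by rewrite /mult_lo; case: ltnP => ik; [rewrite gerDl lerN10 | exact: lbar_ge0]. Qed.

Lemma mult_hi_gt k (i : 'I_(dimu G k)) : lblock lbar k 0 i < mult_hi i.
Proof. by rewrite ltrDl. Qed.

Section BoxSolution.
Variables (r : R) (p : param G) (x : strat G) (l : mult G).
Hypothesis bs : box_solution r p x l.

(** What truncation leaves of complementarity: a multiplier below its reference value is not at its
    upper bound, and one above it is not at its lower bound. *)
Lemma box_sign k (i : 'I_(dimu G k)) :
  0 <= (lblock l k 0 i - lblock lbar k 0 i) * slack p x i.
Proof.
case: (ltgtP (lblock l k 0 i) (lblock lbar k 0 i)) => [lt|gt|->].
- apply: mulr_le0; first by rewrite subr_le0 ltW.
  by apply: (box_slack_le bs); exact: lt_trans lt (mult_hi_gt i).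
- apply: mulr_ge0; first by rewrite subr_ge0 ltW.
  by apply: (box_slack_ge bs); exact: le_lt_trans (mult_lo_le i) gt.
- by rewrite subrr mul0r.
Qed.

(** Provides the constant [M] of [lagrangian_gradient_approx], the same for all truncated
    solutions. *)
Lemma box_mult_bounded : `|l - lbar| <= 1 + `|lbar|.
Proof.
apply: mxrow_norm_le; first by rewrite addr_ge0.
move=> k; apply: row_norm_le => [|i]; first by rewrite addr_ge0.
have -> : submxrow (l - lbar) k 0 i = lblock l k 0 i - lblock lbar k 0 i by rewrite !mxE.
have lb : `|lblock lbar k 0 i| <= `|lbar|.
  by rewrite (le_trans (row_norm_coord _ _)) // submxrow_norm.
have /andP[llo lhi] := box_l bs i.
move: lb; rewrite !ler_norml => /andP[lb1 lb2]; apply/andP; split; last first.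
  by move: lhi; rewrite /mult_hi; have := normr_ge0 lbar; lra.
move: llo; rewrite /mult_lo; have := normr_ge0 lbar; case: ifP => _; lra.
Qed.

Lemma box_mult_ge0 k (i : 'I_(dimu G k)) : (neqc G k <= i)%N -> 0 <= lblock l k 0 i.
Proof. by move=> ik; have /andP[+ _] := box_l bs i; rewrite /mult_lo ltnNge ik. Qed.

Lemma box_inactive k (i : 'I_(dimu G k)) : (neqc G k <= i)%N ->
  lblock lbar k 0 i = 0 -> slack p x i < 0 -> lblock l k 0 i = 0.
Proof.
move=> ik l0 s0; apply/eqP; rewrite eq_le box_mult_ge0 // andbT leNgt; apply/negP => lpos.
have : 0 <= slack p x i by apply: (box_slack_ge bs); rewrite /mult_lo ltnNge ik.
by rewrite leNgt s0.
Qed.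

End BoxSolution.

Section Player.
Variable k : 'I_(nplayers G).

Lemma slack_approx_all (eps : R) : 0 < eps ->
  exists2 C : R, 0 < C & exists2 d : R, 0 < d & forall (i : 'I_(dimu G k)) p x,
    `|p - pbar| <= d -> `|x - xbar| <= d ->
    `|slack p x i - slack pbar xbar i - dotrow (gradg pbar xbar i) (xblock (x - xbar) k)|
    <= eps * `|x - xbar| + C * `|p - pbar|.
Proof.
move=> eps0.
have /choice[Cd HCd] (i : 'I_(dimu G k)) : exists Cd : R * R, 0 < Cd.2 /\
   forall p x, `|p - pbar| <= Cd.2 -> `|x - xbar| <= Cd.2 ->
    `|slack p x i - slack pbar xbar i - dotrow (gradg pbar xbar i) (xblock (x - xbar) k)|
    <= eps * `|x - xbar| + Cd.1 * `|p - pbar|.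
  by have [C C0 [d d0 H]] := slack_approx pbar xbar i eps0; exists (C, d).
have [C C0 HC] := fin_upper_bound (fun i => (Cd i).1).
have [d d0 Hd] := fin_lower_bound (fun i => (HCd i).1).
exists C => //; exists d => // i p x pd xd.
apply: (le_trans ((HCd i).2 p x (le_trans pd (Hd i)) (le_trans xd (Hd i)))).
by rewrite lerD2l ler_wpM2r.
Qed.

Lemma inactive_stable : exists2 d : R, 0 < d & forall (i : 'I_(dimu G k)) p x,
    `|p - pbar| <= d -> `|x - xbar| <= d -> slack pbar xbar i < 0 -> slack p x i < 0.
Proof.
have /choice[dd Hdd] (i : 'I_(dimu G k)) : exists d : R, 0 < d /\ forall p x,
    `|p - pbar| <= d -> `|x - xbar| <= d -> slack pbar xbar i < 0 -> slack p x i < 0.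
  have [C C0 [d d0 H]] := slack_approx pbar xbar i ltr01.
  have [s0|s0] := ltP (slack pbar xbar i) 0; last by exists 1; split => // p x _ _; rewrite ltNge s0.
  (* [B] bounds the growth of the slack per unit of displacement, so displacements up to [d'] cannot
     use up the gap. *)
  pose B := 1 + C + (dimx G k)%:R * `|gradg pbar xbar i|.
  have B0 : 0 < B by rewrite ltr_wpDr ?mulr_ge0 // addr_gt0.
  pose d' := - slack pbar xbar i / (B + 1).
  have B1 : 0 < B + 1 by rewrite addr_gt0.
  have d'0 : 0 < d' by rewrite divr_gt0 // oppr_gt0.
  exists (Num.min d d'); split; first by rewrite lt_min d0.
  move=> p x; rewrite !le_min => /andP[pd pd'] /andP[xd xd'] _.
  have := le_trans (ler_norm _) (H p x pd xd).
  rewrite mul1r lerBlDr lerBlDr => /le_lt_trans; apply.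
  have Hg : dotrow (gradg pbar xbar i) (xblock (x - xbar) k) <= (dimx G k)%:R * `|gradg pbar xbar i| * d'.
    rewrite (le_trans (ler_norm _)) // (le_trans (dotrow_norm _ _)) // ler_wpM2l ?mulr_ge0 //.
    by rewrite (le_trans (xblock_norm _ _)).
  have Hp : C * `|p - pbar| <= C * d' by rewrite ler_pM2l.
  have Bd : (B + 1) * d' = - slack pbar xbar i by rewrite /d' mulrCA divff ?mulr1 // gt_eqF.
  rewrite -ltrBrDr sub0r -Bd mulrDl mul1r.
  apply: (@le_lt_trans _ _ (B * d')); last by rewrite ltrDl.
  by rewrite /B !mulrDl mul1r; apply: lerD => //; exact: lerD.
have [d d0 Hd] := fin_lower_bound (fun i => (Hdd i).1).
exists d => // i p x pd xd.
by apply: (Hdd i).2; exact: le_trans _ (Hd i).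
Qed.

(** Testing at distance [r] against the force bounds r times its l^1 norm from above, and
    [smfcq_bound] bounds this norm from below by a multiple of |s|. The condition with [eta] makes
    the slack errors due to the parameter small against [r]. *)
Lemma mult_bound : SMFCQ pbar xbar lbar k ->
  exists2 C : R, 0 < C & exists2 r0 : R, 0 < r0 & exists2 eta : R, 0 < eta &
  forall r p x l, 0 < r -> r <= r0 -> `|p - pbar| <= eta * r -> `|p - pbar| <= r0 ->
    box_solution r p x l ->
    `|lblock l k - lblock lbar k| <= C * (`|x - xbar| + `|p - pbar|).
Proof.
move=> /smfcq_bound[c c0 Hc].
have [C1 C10 [d1 d10 H1]] := lagrangian_gradient_approx hKKT k (1 + `|lbar|).
pose m : R := (dimu G k)%:R; have m0 : 0 <= m by exact: ler0n.
have m1 : 0 < m + 1 by rewrite ltr_wpDl.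
(* [eps], and [eta] below, are chosen so that m * eps <= c / 4 and m * C2 * e <= c / 4 * r. *)
pose eps := c / 4 / (m + 1).
have eps0 : 0 < eps by rewrite !divr_gt0.
have [C2 C20 [d2 d20 H2]] := slack_approx_all eps0.
have [d3 d30 H3] := inactive_stable.
pose eta := c / 4 / ((m + 1) * C2).
have eta0 : 0 < eta by rewrite divr_gt0 ?divr_gt0 // mulr_gt0.
exists (4 * C1 / c); first by rewrite divr_gt0 // mulr_gt0.
exists (Num.min d1 (Num.min d2 d3)); first by rewrite !lt_min d10 d20.
exists eta => // r p x l r0; rewrite !le_min => /and3P[rd1 rd2 rd3] pe /and3P[pd1 pd2 pd3] bs.
have xr := box_x bs.
set t := `|x - xbar| in xr *; set e := `|p - pbar| in pe pd1 pd2 pd3 *.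
set s := lblock l k - lblock lbar k.
set N := mult_force pbar xbar lbar k l.
have t0 : 0 <= t by exact: normr_ge0.
have e0 : 0 <= e by exact: normr_ge0.
have sE i : s 0 i = lblock l k 0 i - lblock lbar k 0 i by rewrite !mxE.
have s_inact (i : 'I_(dimu G k)) : (neqc G k <= i)%N -> lblock lbar k 0 i = 0 -> slack pbar xbar i < 0 -> s 0 i = 0.
  move=> ik li si; rewrite sE li subr0; apply: (box_inactive bs ik li).
  exact: H3 _ _ _ pd3 (le_trans xr rd3) si.
have cs : c * `|s| <= \sum_a `|N 0 a|.
  have -> : N = \sum_i s 0 i *: gradg pbar xbar i.
    by apply: eq_bigr => i _; rewrite sE.
  apply: Hc => i.
    by case: (slack_bar_cases i) => [[-> //]|[->]// |[ik li si] _ _]; exact: s_inact.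
  rewrite !inE => /and3P[ik /eqP li _]; rewrite sE li subr0; exact: (box_mult_ge0 bs).
(* The negated sign vector has sup norm at most 1, and its pairing with [N] is minus the l^1 norm of
   [N]. *)
pose z := xblock xbar k + r *: (\row_a (- Num.sg (N 0 a))).
pose D := xblock (x - xbar) k.
have zE : z - xblock x k = r *: (\row_a (- Num.sg (N 0 a))) - D.
  by rewrite /z /D xblockB opprB addrAC addrC.
have sgn : `|\row_a (- Num.sg (N 0 a)) : 'rV[R]_(dimx G k)| <= 1.
  apply: row_norm_le => // a; rewrite mxE normrN normr_sg.
  by case: (_ != _).
have zr : `|z - xblock xbar k| <= r.
  by rewrite /z addrC addKr normrZ gtr0_norm // ler_piMr // ltW.
have vi := box_vi bs zr.
have F1 := H1 p x l pd1 (le_trans xr rd1) (box_mult_bounded bs) (z - xblock x k).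
have zn : `|z - xblock x k| <= r + t.
  rewrite zE (le_trans (ler_normB _ _)) // lerD //; last exact: xblock_norm.
  by rewrite normrZ gtr0_norm // ler_piMr // ltW.
have F2 : 0 <= dotrow N (z - xblock x k) + C1 * (t + e) * (r + t).
  have B0 : 0 <= C1 * (t + e) by apply: mulr_ge0; [exact: ltW | exact: addr_ge0].
  have := le_trans (ler_norm _) (le_trans F1 (ler_wpM2l B0 zn)).
  set A := 'D_ _ _ _; set V := dotrow (vpar p k) _ => F2.
  have VA : V <= A by exact: vi.
  exact: force_arith F2 VA.
have Nd : dotrow N (z - xblock x k) = - r * (\sum_a `|N 0 a|) - dotrow N D.
  rewrite zE dotrowBr dotrowZr mulNr -mulrN; congr (r * _ - _).
  rewrite dotrowE -sumrN; apply: eq_bigr => a _.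
  by rewrite mxE mulrN mulrC -normrEsg.
(* On constraints active at the reference point the linearization differs from the slack by a small
   error, and the slack itself has a favourable sign by [box_sign]; the remaining multipliers
   vanish. *)
have ND : - dotrow N D <= `|s| * (m * (eps * t + C2 * e)).
  rewrite dotrow_suml -sumrN mulrCA.
  apply: (@le_trans _ _ (\sum_(i < dimu G k) `|s| * (eps * t + C2 * e))); last first.
    by rewrite sumr_const card_ord -[leLHS]mulr_natl.
  apply: ler_sum => i _; rewrite -sE.
  have sn : `|s 0 i| <= `|s| by exact: row_norm_coord.
  have E0 : 0 <= eps * t + C2 * e by rewrite addr_ge0 // mulr_ge0 // ltW.
  have [a1 | [ik li si]] : slack pbar xbar i = 0 \/ [/\ (neqc G k <= i)%N, lblock lbar k 0 i = 0 & slack pbar xbar i < 0].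
    by case: (slack_bar_cases i) => [[_ ?]|[_ ?]|?]; [left|left|right].
    have := H2 i p x pd2 (le_trans xr rd2); rewrite a1 subr0 -/D => F3.
    have := box_sign bs i; rewrite -sE => sg.
    apply: (@le_trans _ _ (`|s 0 i| * (eps * t + C2 * e))); last exact: ler_wpM2r.
    have -> : - (s 0 i * dotrow (gradg pbar xbar i) D) =
      s 0 i * (slack p x i - dotrow (gradg pbar xbar i) D) - s 0 i * slack p x i by rewrite mulrBr; ring.
    rewrite lerBlDr (le_trans (ler_norm _)) // normrM.
    by rewrite ler_wpDr // ler_wpM2l.
  by rewrite s_inact // mul0r oppr0 mulr_ge0.
apply: (@mult_bound_arith _ c m eps C1 C2 r t e `|s| (\sum_a `|N 0 a|)) => //.
- by rewrite /eps mulrA ler_pdivrMr // mulrC ler_pM2l ?divr_gt0 // lerDl.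
- by rewrite t0.
- have -> : c / 4 = (m + 1) * C2 * eta by rewrite /eta [RHS]mulrC divfK // gt_eqF // mulr_gt0.
  rewrite -[leRHS]mulrA; apply: ler_pM => //; first by rewrite mulr_ge0 // ltW.
  by apply: ler_wpM2r; [exact: ltW | rewrite lerDl].
- exact: ltW.
- by move: F2 ND; rewrite Nd mulNr; lra.
Qed.

End Player.
End Local.

(** * Second-order and cone estimates for the displacement *)

Lemma pform_arith (R : realType) (f1 f2 dv Q S eps t e C K : R) :
  f1 - f2 - dv <= S -> S <= K * (t + e) * e -> 
  `|f1 - f2 - dv - Q| <= eps * (t + e) ^+ 2 + C * t * e ->
  0 <= t -> 0 <= e -> 0 <= C ->
  Q <= eps * (t + e) ^+ 2 + (C + K) * (t + e) * e.
Proof.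
move=> H1 H2; rewrite ler_norml => /andP[H3 _] t0 e0 C0.
have H4 : C * t * e <= C * (t + e) * e.
  by apply: ler_wpM2r => //; apply: ler_wpM2l => //; rewrite lerDl.
have -> : (C + K) * (t + e) * e = C * (t + e) * e + K * (t + e) * e by ring.
lra.
Qed.

Lemma vi_arith (R : realType) (A V f1 f2 S1 S2 : R) :
  - V <= A -> A <= f2 + S2 - (f1 + S1) -> f1 - f2 - V <= S2 - S1.
Proof. lra. Qed.

Section Local.
Variables (R : realType) (G : NEP R) (pbar : param G) (xbar : strat G) (lbar : mult G).
Hypothesis hKKT : S_KKT pbar (xbar, lbar).
Hypothesis hconv : convex_assumptions G.
Implicit Types (p : param G) (x : strat G) (l : mult G).
Notation box_solution := (box_solution xbar lbar).

Section Player.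
Variable k : 'I_(nplayers G).

Lemma ell_shift (l lb : 'rV[R]_(dimu G k)) z : ell l z =
  ell lb z + \sum_i (l 0 i - lb 0 i) * constr G k i (block_pair k z).
Proof.
rewrite /ell -addrA -big_split; congr (_ + _); apply: eq_bigr => i _ /=.
by rewrite -mulrDl addrC subrK.
Qed.

(** Passing from l to lbar in the convexity comparison costs the sum of s_i * (slack at xbar - slack
    at x), both taken at p. The part at x is dropped by [box_sign]; the part at xbar is |s| *
    O(e). *)
Lemma pform_bound (C3 eps : R) : 0 < C3 -> 0 < eps ->
  exists2 C : R, 0 < C & exists2 d : R, 0 < d & forall r p x l, 0 < r ->
    `|p - pbar| <= d -> `|x - xbar| <= d -> box_solution r p x l ->
    `|lblock l k - lblock lbar k| <= C3 * (`|x - xbar| + `|p - pbar|) ->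
    pform pbar xbar lbar k (x - xbar) <= eps * (`|x - xbar| + `|p - pbar|) ^+ 2
       + C * (`|x - xbar| + `|p - pbar|) * `|p - pbar|.
Proof.
move=> C30 eps0.
have [C1 C10 [d1 d10 H1]] := lagrangian_diff_approx hKKT k eps0.
have [C2 C20 [d2 d20 H2]] := slack_approx_all pbar xbar k (@ltr01 R).
have [d3 d30 H3] := inactive_stable pbar xbar k.
pose m : R := (dimu G k)%:R; have m0 : 0 <= m by exact: ler0n.
exists (C1 + m * C3 * C2); first by rewrite ltr_wpDr // !mulr_ge0 // ltW.
exists (Num.min d1 (Num.min d2 d3)); first by rewrite !lt_min d10 d20.
move=> r p x l r0; rewrite !le_min => /and3P[pd1 pd2 pd3] /and3P[xd1 xd2 xd3] bs.
set t := `|x - xbar|; set e := `|p - pbar|; set s := lblock l k - lblock lbar k => sb.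
have t0 : 0 <= t by exact: normr_ge0.
have e0 : 0 <= e by exact: normr_ge0.
have F1 := H1 p x pd1 xd1; rewrite -/t -/e in F1.
have xx : `|xblock xbar k - xblock xbar k| <= r by rewrite subrr normr0 ltW.
have vi := box_vi bs xx.
have l0 (i : 'I_(dimu G k)) : (neqc G k <= i)%N -> 0 <= lblock l k 0 i by exact: (box_mult_ge0 bs).
have de := derive_ell_le (wpar p k) x (xblock xbar k - xblock x k) hconv l0.
rewrite -deviateE !(ell_shift (lblock l k) (lblock lbar k)) in de.
have V : dotrow (vpar p k) (xblock xbar k - xblock x k) = - dotrow (vpar p k) (xblock (x - xbar) k).
  by rewrite xblockB -opprB dotrowNr.
rewrite V in vi.
have H := vi_arith vi de.
apply: (pform_arith H _ F1 t0 e0 (ltW C10)).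
rewrite -sumrB.
apply: (@le_trans _ _ (\sum_(i < dimu G k) (C3 * (t + e)) * (C2 * e))); last first.
  rewrite sumr_const card_ord -[leLHS]mulr_natl -/m le_eqVlt; apply/orP; left; apply/eqP.
  by ring.
apply: ler_sum => i _; rewrite -mulrBr.
have -> : lblock l k 0 i - lblock lbar k 0 i = s 0 i by rewrite !mxE.
have -> : constr G k i (block_pair k (deviate x (xblock xbar k), wpar p k))
   - constr G k i (block_pair k (x, wpar p k)) = slack p xbar i - slack p x i.
  rewrite /slack /block_pair /= -/(xblock _ _) -/(xblock _ _) xblock_deviate.
  by rewrite opprB addrA subrK.
have sE : s 0 i = lblock l k 0 i - lblock lbar k 0 i by rewrite !mxE.
have B0 : 0 <= C3 * (t + e) * (C2 * e) by rewrite !mulr_ge0 ?addr_ge0 // ltW.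
have [a1 | [ik li si]] : slack pbar xbar i = 0 \/ [/\ (neqc G k <= i)%N, lblock lbar k 0 i = 0 & slack pbar xbar i < 0].
  by case: (slack_bar_cases hKKT i) => [[_ ?]|[_ ?]|?]; [left|left|right].
  have := box_sign hKKT bs i; rewrite -sE => sg.
  (* At x = xbar the slack of an active constraint moves with the parameter alone, hence is O(e). *)
  have := H2 i p xbar pd2; rewrite subrr normr0 a1 subr0 mulr0 add0r => /(_ (ltW d20)).
  have -> : dotrow (gradg pbar xbar i) (xblock (0 : strat G) k) = 0.
    by rewrite /xblock submxrow0 /dotrow trmx0 mulmx0 mxE.
  rewrite subr0 -/e => F2.
  rewrite mulrBr lerBlDr (le_trans (ler_norm _)) // ler_wpDr // normrM.
  by apply: ler_pM => //; apply: le_trans sb; exact: row_norm_coord.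
rewrite sE li subr0 (box_inactive bs ik li) ?mul0r //.
exact: H3 _ _ _ pd3 xd3 si.
Qed.

(** Multipliers close to lbar stay below their upper bounds, and those in I1 also above their lower
    bounds. So the slacks are nonpositive, those in I1 zero, and linearization carries this over to
    x - xbar. *)
Lemma cone_bound (C3 eps : R) : 0 < C3 -> 0 < eps ->
  exists2 C : R, 0 < C & exists2 d : R, 0 < d & forall r p x l, 0 < r ->
    `|p - pbar| <= d -> `|x - xbar| <= d -> box_solution r p x l ->
    `|lblock l k - lblock lbar k| <= C3 * (`|x - xbar| + `|p - pbar|) ->
    forall i : 'I_(dimu G k),
    (i \in I1 pbar xbar lbar k ->
      `|dotrow (gradg pbar xbar i) (xblock (x - xbar) k)| <= eps * `|x - xbar| + C * `|p - pbar|) /\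
    (i \in I2 pbar xbar lbar k ->
      dotrow (gradg pbar xbar i) (xblock (x - xbar) k) <= eps * `|x - xbar| + C * `|p - pbar|).
Proof.
move=> C30 eps0.
have [C2 C20 [d2 d20 H2]] := slack_approx_all pbar xbar k eps0.
(* A multiplier that moves by less than this gap does not reach an artificial bound, nor 0 if it was
   positive. *)
have gap0 (i : 'I_(dimu G k)) : 0 < (if 0 < lblock lbar k 0 i then Num.min 1 (lblock lbar k 0 i) else 1).
  by case: ifP => // l0; rewrite lt_min ltr01.
have [g g0 Hg] := fin_lower_bound gap0.
(* With t and e at most g / (4 * C3), the multipliers move by at most g / 2. *)
exists C2 => //; exists (Num.min d2 (g / (4 * C3))).
  by rewrite lt_min d20 divr_gt0 // mulr_gt0.
move=> r p x l r0; rewrite !le_min => /andP[pd2 pd3] /andP[xd2 xd3] bs sb i.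
set t := `|x - xbar| in xd2 xd3 sb *; set e := `|p - pbar| in pd2 pd3 sb *.
pose s := lblock l k - lblock lbar k.
have sg : `|lblock l k 0 i - lblock lbar k 0 i| < g.
  have -> : lblock l k 0 i - lblock lbar k 0 i = s 0 i by rewrite !mxE.
  apply: (le_lt_trans (row_norm_coord _ _)); apply: (le_lt_trans sb).
  apply: (@le_lt_trans _ _ (g / 2)); last by rewrite gtr_pMr // invf_lt1 // ltr1n.
  have -> : g / 2 = C3 * (g / (4 * C3) + g / (4 * C3)) by field; rewrite gt_eqF.
  by rewrite ler_pM2l // lerD.
have F2 := H2 i p x pd2 xd2; rewrite -/t -/e in F2.
have Hgi := Hg i.
move: sg; rewrite ltr_norml => /andP[sg1 sg2].
have g1 : g <= 1.
  by apply: (le_trans Hgi); case: ifP => _ //; rewrite ge_min lexx.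
have lhi : lblock l k 0 i < mult_hi lbar i.
  by rewrite /mult_hi; move: sg2 g1; set a := lblock l k 0 i; set b := lblock lbar k 0 i; lra.
have sle := box_slack_le bs lhi.
split=> [i1|i2].
  have s0 : slack pbar xbar i = 0.
    have := slack_bar_cases hKKT i; case=> [[_ ->//]|[_ ->//]|[ik li _]].
    by move: i1; rewrite inE li ltxx /= orbF ltnNge ik.
  have slo : mult_lo lbar i < lblock l k 0 i.
    move: i1 Hgi; rewrite inE /mult_lo; case: ltnP => [ik _ _|ik /= /andP[lpos _]].
      by move: sg1 g1; set a := lblock l k 0 i; set b := lblock lbar k 0 i; lra.
    rewrite lpos le_min => /andP[_ gl].
    by move: sg1 gl; set a := lblock l k 0 i; set b := lblock lbar k 0 i; lra.
  have sx : slack p x i = 0 by apply/eqP; rewrite eq_le sle (box_slack_ge bs slo).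
  by move: F2; rewrite sx s0 subrr sub0r normrN.
have s0 : slack pbar xbar i = 0.
  by move: i2; rewrite inE => /and3P[_ _ /eqP].
move: F2; rewrite s0 subr0 distrC => /(le_trans (ler_norm _)).
rewrite lerBlDr => /le_trans; apply; by rewrite gerDl.
Qed.

End Player.

End Local.

(** * Existence and isolated calmness *)

Section Final.
Variables (R : realType) (G : NEP R) (pbar : param G) (xbar : strat G) (lbar : mult G).
Hypothesis hKKT : S_KKT pbar (xbar, lbar).
Hypothesis hconv : convex_assumptions G.
Hypothesis hSMFCQ : forall k : 'I_(nplayers G), SMFCQ pbar xbar lbar k.
Hypothesis hP : P_property pbar xbar lbar (Kcone pbar xbar lbar).
Implicit Types (p : param G) (x : strat G) (l : mult G).
Notation box_solution := (box_solution xbar lbar).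

(** * Estimates with constants common to all players *)

Lemma mult_bound_all :
  exists2 C : R, 0 < C & exists2 r0 : R, 0 < r0 & exists2 eta : R, 0 < eta &
  forall r p x l, 0 < r -> r <= r0 -> `|p - pbar| <= eta * r -> `|p - pbar| <= r0 ->
    box_solution r p x l -> forall k,
    `|lblock l k - lblock lbar k| <= C * (`|x - xbar| + `|p - pbar|).
Proof.
have /choice[T HT] k : exists T : R * R * R, [/\ 0 < T.1.1, 0 < T.1.2, 0 < T.2 &
  forall r p x l, 0 < r -> r <= T.1.2 -> `|p - pbar| <= T.2 * r -> `|p - pbar| <= T.1.2 ->
    box_solution r p x l ->
    `|lblock l k - lblock lbar k| <= T.1.1 * (`|x - xbar| + `|p - pbar|)].
  have [C C0 [r0 r00 [eta eta0 H]]] := mult_bound hKKT (hSMFCQ k).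
  by exists (C, r0, eta).
have T2 k : 0 < (T k).1.2 by case: (HT k).
have T3 k : 0 < (T k).2 by case: (HT k).
have [C C0 HC] := fin_upper_bound (fun k => (T k).1.1).
have [r0 r00 Hr0] := fin_lower_bound T2.
have [eta eta0 Heta] := fin_lower_bound T3.
exists C => //; exists r0 => //; exists eta => // r p x l rpos rr pe pr bs k.
have [_ _ _ H] := HT k.
apply: (le_trans (H r p x l rpos (le_trans rr (Hr0 k)) _ (le_trans pr (Hr0 k)) bs)).
  by rewrite (le_trans pe) // ler_pM2r.
by apply: ler_wpM2r => //; exact: addr_ge0.
Qed.

Lemma pform_bound_all (C3 eps : R) : 0 < C3 -> 0 < eps ->
  exists2 C : R, 0 < C & exists2 d : R, 0 < d & forall r p x l k, 0 < r ->
    `|p - pbar| <= d -> `|x - xbar| <= d -> box_solution r p x l ->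
    `|lblock l k - lblock lbar k| <= C3 * (`|x - xbar| + `|p - pbar|) ->
    pform pbar xbar lbar k (x - xbar) <= eps * (`|x - xbar| + `|p - pbar|) ^+ 2
       + C * (`|x - xbar| + `|p - pbar|) * `|p - pbar|.
Proof.
move=> C30 eps0.
have /choice[T HT] k : exists T : R * R, 0 < T.2 /\ forall r p x l, 0 < r ->
    `|p - pbar| <= T.2 -> `|x - xbar| <= T.2 -> box_solution r p x l ->
    `|lblock l k - lblock lbar k| <= C3 * (`|x - xbar| + `|p - pbar|) ->
    pform pbar xbar lbar k (x - xbar) <= eps * (`|x - xbar| + `|p - pbar|) ^+ 2
       + T.1 * (`|x - xbar| + `|p - pbar|) * `|p - pbar|.
  by have [C C0 [d d0 H]] := pform_bound hKKT hconv k C30 eps0; exists (C, d).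
have [C C0 HC] := fin_upper_bound (fun k => (T k).1).
have [d d0 Hd] := fin_lower_bound (fun k => (HT k).1).
exists C => //; exists d => // r p x l k rpos pd xd bs sb.
apply: (le_trans ((HT k).2 r p x l rpos (le_trans pd (Hd k)) (le_trans xd (Hd k)) bs sb)).
by rewrite lerD2l ler_wpM2r // ler_wpM2r // addr_ge0.
Qed.

Lemma cone_bound_all (C3 eps : R) : 0 < C3 -> 0 < eps ->
  exists2 C : R, 0 < C & exists2 d : R, 0 < d & forall r p x l k, 0 < r ->
    `|p - pbar| <= d -> `|x - xbar| <= d -> box_solution r p x l ->
    `|lblock l k - lblock lbar k| <= C3 * (`|x - xbar| + `|p - pbar|) ->
    forall i : 'I_(dimu G k),
    (i \in I1 pbar xbar lbar k ->
      `|dotrow (gradg pbar xbar i) (xblock (x - xbar) k)| <= eps * `|x - xbar| + C * `|p - pbar|) /\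
    (i \in I2 pbar xbar lbar k ->
      dotrow (gradg pbar xbar i) (xblock (x - xbar) k) <= eps * `|x - xbar| + C * `|p - pbar|).
Proof.
move=> C30 eps0.
have /choice[T HT] k : exists T : R * R, 0 < T.2 /\ forall r p x l, 0 < r ->
    `|p - pbar| <= T.2 -> `|x - xbar| <= T.2 -> box_solution r p x l ->
    `|lblock l k - lblock lbar k| <= C3 * (`|x - xbar| + `|p - pbar|) ->
    forall i : 'I_(dimu G k),
    (i \in I1 pbar xbar lbar k ->
      `|dotrow (gradg pbar xbar i) (xblock (x - xbar) k)| <= eps * `|x - xbar| + T.1 * `|p - pbar|) /\
    (i \in I2 pbar xbar lbar k ->
      dotrow (gradg pbar xbar i) (xblock (x - xbar) k) <= eps * `|x - xbar| + T.1 * `|p - pbar|).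
  by have [C C0 [d d0 H]] := cone_bound hKKT k C30 eps0;
    exists (C, d).
have [C C0 HC] := fin_upper_bound (fun k => (T k).1).
have [d d0 Hd] := fin_lower_bound (fun k => (HT k).1).
exists C => //; exists d => // r p x l k rpos pd xd bs sb i.
have [h1 h2] := (HT k).2 r p x l rpos (le_trans pd (Hd k)) (le_trans xd (Hd k)) bs sb i.
have le : eps * `|x - xbar| + (T k).1 * `|p - pbar| <= eps * `|x - xbar| + C * `|p - pbar|.
  by rewrite lerD2l ler_wpM2r.
by split=> [/h1|/h2] h; exact: le_trans h le.
Qed.

(** A unit vector outside the cone violates one of its conditions, one inside makes some bracket
    positive. [sphere_gap] gives both alternatives a common margin, so that vectors merely close to
    the cone are covered. *)
Lemma P_gap : exists2 c : R, 0 < c & forall y : strat G, `|y| = 1 ->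
  exists k, [\/ c <= pform pbar xbar lbar k y,
    exists2 i, i \in I1 pbar xbar lbar k & c <= `|dotrow (gradg pbar xbar i) (xblock y k)|
  | exists2 i, i \in I2 pbar xbar lbar k & c <= dotrow (gradg pbar xbar i) (xblock y k)].
Proof.
pose h (o : {k : 'I_(nplayers G) & option 'I_(dimu G k)}) (y : strat G) : R :=
  let k := tag o in
  if tagged o is Some i then
    if i \in I1 pbar xbar lbar k then `|dotrow (gradg pbar xbar i) (xblock y k)|
    else if i \in I2 pbar xbar lbar k then dotrow (gradg pbar xbar i) (xblock y k) else 0
  else pform pbar xbar lbar k y.
have hc o : continuous (h o).
  case: o => k [i|]; rewrite /h /=; last exact: continuous_pform.
  have dc : continuous (fun y : strat G => dotrow (gradg pbar xbar i) (xblock y k)).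
    have -> : (fun y : strat G => dotrow (gradg pbar xbar i) (xblock y k)) =
      (fun y => \sum_a gradg pbar xbar i 0 a * y 0 (tagnat.Rank k a)).
      by apply/funext => y; rewrite dotrowE; apply: eq_bigr => a _; rewrite !mxE.
    by apply: continuous_sum => a; apply: continuous_mul; [exact: cst_continuous | exact: coord_continuous].
  case: (i \in I1 _ _ _ _); first exact: continuous_abs.
  case: (i \in I2 _ _ _ _) => //; exact: cst_continuous.
have hpos (y : strat G) : `|y| = 1 -> exists o, 0 < h o y.
  move=> y1; have y0 : y != 0 by rewrite -normr_eq0 y1 oner_eq0.
  have [yK|yK] := pselect (Kcone pbar xbar lbar y).
    have /bigmax_gtP[|[k _]] := hP y0 yK; first by rewrite ltNge leNye.
    by rewrite lte_fin => H; exists (existT _ k None).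
  apply: contrapT => /forallNP H; apply: yK => k.
  have {}H o : h o y <= 0 by rewrite leNgt; exact/negP/H.
  split=> i ik.
    have := H (existT _ k (Some i)); rewrite /h /= ik normr_le0 => /eqP //.
  have := H (existT _ k (Some i)); rewrite /h /= ik.
  by case: ifP => // _ /(le_trans (ler_norm _)).
have [c c0 Hc] := sphere_gap hc hpos.
exists c => // y y1; have [[k [i|]]] := Hc y y1; rewrite /h /=; last by exists k; apply: Or31.
case: ifP => [i1|_]; first by exists k; apply: Or32; exists i.
case: ifP => [i2|_]; first by exists k; apply: Or33; exists i.
by rewrite leNgt c0.
Qed.

(** As e <= t, (t + e)^2 <= 4 t^2; the weight c / 8 thus absorbs half of c t^2, and a factor t
    cancels. *)
Lemma calm_arith1 (c C t e : R) : 0 < c -> 0 < C -> 0 <= e -> e <= t -> 0 < t ->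
  c * t ^+ 2 <= c / 8 * (t + e) ^+ 2 + C * (t + e) * e -> t <= 4 * C / c * e.
Proof.
move=> c0 C0 e0 et t0 H.
have H1 : c / 8 * (t + e) ^+ 2 <= c / 8 * (4 * t ^+ 2).
  by apply: ler_wpM2l; [rewrite divr_ge0 // ltW | nra].
have H2 : C * (t + e) * e <= C * (2 * t) * e.
  by apply: ler_wpM2r => //; apply: ler_wpM2l; [exact: ltW | lra].
have H3 : (c / 2 * t) * t <= (2 * C * e) * t by move: H H1 H2; nra.
rewrite ler_pM2r // in H3.
have -> : 4 * C / c * e = (2 * C * e) / (c / 2) by field; rewrite gt_eqF.
by rewrite ler_pdivlMr ?divr_gt0 // mulrC.
Qed.

Lemma calm_arith2 (c C t e : R) : 0 < c ->
  c * t <= c / 2 * t + C * e -> t <= 2 * C / c * e.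
Proof.
move=> c0 H.
have -> : 2 * C / c * e = (C * e) / (c / 2) by field; rewrite gt_eqF.
by rewrite ler_pdivlMr ?divr_gt0 // mulrC; move: H; lra.
Qed.

Lemma box_solution_calm : exists2 kappa : R, 0 < kappa & exists2 r : R, 0 < r &
  exists2 d : R, 0 < d & forall p x l, `|p - pbar| <= d -> box_solution r p x l ->
   `|x - xbar| <= kappa * `|p - pbar| /\ `|l - lbar| <= kappa * `|p - pbar|.
Proof.
have [c c0 Hc] := P_gap.
have [C3 C30 [r0 r00 [eta eta0 H3]]] := mult_bound_all.
have c8 : 0 < c / 8 by rewrite divr_gt0.
have c2 : 0 < c / 2 by rewrite divr_gt0.
have [C4 C40 [d4 d40 H4]] := pform_bound_all C30 c8.
have [C5 C50 [d5 d50 H5]] := cone_bound_all C30 c2.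
(* One summand for each way of bounding t: t <= e, a large bracket, a violated cone condition. *)
pose A := 1 + 4 * C4 / c + 2 * C5 / c.
have A4 : 0 < 4 * C4 / c by rewrite divr_gt0 // mulr_gt0.
have A5 : 0 < 2 * C5 / c by rewrite divr_gt0 // mulr_gt0.
have A0 : 0 < A by rewrite !addr_gt0.
pose r := Num.min r0 (Num.min d4 d5).
have rpos : 0 < r by rewrite !lt_min r00 d40.
have [rr0 [rd4 rd5]] : r <= r0 /\ r <= d4 /\ r <= d5.
  by rewrite /r !ge_min !lexx !orbT.
(* [A] serves x; inserting t <= A * e into the multiplier bound gives C3 * (A + 1) for l. *)
exists (A + C3 * (A + 1)); first by rewrite addr_gt0 // mulr_gt0 // addr_gt0.
exists r => //; exists (Num.min r (eta * r)); first by rewrite lt_min rpos mulr_gt0.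
move=> p x l; rewrite le_min => /andP[pr pe] bs.
have xr := box_x bs.
have sb := H3 r p x l rpos rr0 pe (le_trans pr rr0) bs.
set t := `|x - xbar| in xr sb *; set e := `|p - pbar| in pr pe sb *.
have t0 : 0 <= t by exact: normr_ge0.
have e0 : 0 <= e by exact: normr_ge0.
have tA : t <= A * e.
  have [te|et] := leP t e; first by rewrite (le_trans te) // ler_peMl // /A -addrA lerDl addr_ge0 // ltW.
  have tpos : 0 < t by exact: le_lt_trans et.
  have y1 : `|t^-1 *: (x - xbar)| = 1 by rewrite normrZ gtr0_norm ?invr_gt0 // mulVf // gt_eqF.
  have [k [cp|[i i1 ci]|[i i2 ci]]] := Hc _ y1.
  - move: cp; rewrite pformZ exprVn mulrC ler_pdivlMr ?exprn_gt0 // => cp.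
    have := le_trans cp (H4 r p x l k rpos (le_trans pr rd4) (le_trans xr rd4) bs (sb k)).
    move=> /(calm_arith1 c0 C40 e0 (ltW et) tpos) h.
    by rewrite (le_trans h) // ler_wpM2r // /A; lra.
  - move: ci; rewrite xblockZ dotrowZr normrM gtr0_norm ?invr_gt0 // mulrC ler_pdivlMr // => ci.
    have := le_trans ci ((H5 r p x l k rpos (le_trans pr rd5) (le_trans xr rd5) bs (sb k) i).1 i1).
    move=> /(calm_arith2 c0) h.
    by rewrite (le_trans h) // ler_wpM2r // /A; lra.
  - move: ci; rewrite xblockZ dotrowZr mulrC ler_pdivlMr // => ci.
    have := le_trans ci ((H5 r p x l k rpos (le_trans pr rd5) (le_trans xr rd5) bs (sb k) i).2 i2).
    move=> /(calm_arith2 c0) h.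
    by rewrite (le_trans h) // ler_wpM2r // /A; lra.
have K0 : 0 <= C3 * (A + 1) by rewrite mulr_ge0 ?addr_ge0 // ltW.
split; first by rewrite (le_trans tA) // ler_wpM2r // lerDl.
apply: (@le_trans _ _ (C3 * (A + 1) * e)); last by rewrite ler_wpM2r // lerDr ltW.
apply: mxrow_norm_le => [|k]; first exact: mulr_ge0.
rewrite submxrowB (le_trans (sb k)) // -mulrA ler_pM2l // mulrDl mul1r lerD2r //.
Qed.

End Final.

(** * Solvability of the truncated system and its relation to the KKT system *)

Section Existence.
Variables (R : realType) (G : NEP R) (xbar : strat G) (lbar : mult G).
Implicit Types (p : param G) (x : strat G) (l : mult G).
Notation box_solution := (box_solution xbar lbar).

(** Stationarity residuals over negated slacks, the negation because multipliers maximize the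
    Lagrangian. *)
Definition box_field p (w : 'rV[R]_(\sum_j dimx G j + \sum_j dimu G j)) :
    'rV[R]_(\sum_j dimx G j + \sum_j dimu G j) :=
  row_mx
    (\mxrow_k \row_a ('D_(emb (delta_mx 0 a : 'rV[R]_(dimx G k)), 0)
       (ell (lblock (rsubmx w : mult G) k)) (lsubmx w, wpar p k) - vpar p k 0 a))
    (\mxrow_k \row_i (- slack p (lsubmx w) (i : 'I_(dimu G k)))).

Lemma continuous_pairl n m d (c : 'rV[R]_d) :
  continuous (fun w : 'rV[R]_(n + m) => (lsubmx w, c)).
Proof.
move=> w; apply: differentiable_continuous; apply: differentiable_pair.
  exact: differentiable_lsubmx.
exact: differentiable_cst.
Qed.

(** The multipliers are part of the variable, so continuity is read off [derive_ell], where they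
    occur as coefficients. *)
Lemma box_field_continuous p j : continuous (fun w => box_field p w 0 j).
Proof.
have comp (T U : topologicalType) (f : T -> U) (g : U -> R) : continuous f -> continuous g ->
    continuous (fun w => g (f w)).
  by move=> fc gc w; exact: (continuous_comp (fc w) (gc _)).
have cC k (F : _ -> R) : continuous F ->
    continuous (fun w : 'rV[R]_(\sum_j dimx G j + \sum_j dimu G j) =>
      F (block_pair k (lsubmx w, wpar p k))).
  move=> Fc; apply: (comp _ _ _ (fun z => F (block_pair k z))); first exact: continuous_pairl.
  by apply: comp => //; exact: block_pair_continuous.
rewrite /box_field; case: (split_ordP j) => a ->.
  set k := tagnat.sig1 a; set e := delta_mx 0 (tagnat.sig2 a) : 'rV[R]_(dimx G k).
  have E w : box_field p w 0 (lshift _ a) = ('D_(emb e, 0) (cost G k) (lsubmx w, wpar p k)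
      + \sum_i w 0 (rshift _ (tagnat.Rank k i)) *
       'D_(block_pair k (emb e, 0)) (constr G k i) (block_pair k (lsubmx w, wpar p k)))
      + - vpar p k 0 (tagnat.sig2 a).
    rewrite /box_field row_mxEl !mxE derive_ell; congr (_ + _ - _).
    by apply: eq_bigr => i _; rewrite !mxE.
  have -> : (fun w => box_field p w 0 (lshift _ a)) = _ := funext E.
  apply: continuous_add; last exact: cst_continuous.
  apply: continuous_add.
    apply: (comp _ _ _ (fun z => 'D_(emb e, 0) (cost G k) z)); first exact: continuous_pairl.
    by have [_ /(_ (emb e, 0)) C] := cost_C2 k; exact: (@Cdiff_continuous _ _ 1 _ C).
  apply: continuous_sum => i; apply: continuous_mul; first exact: coord_continuous.
  apply: (cC _ (fun z => 'D_(block_pair k (emb e, 0)) (constr G k i) z)).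
  by have [_ /(_ (block_pair k (emb e, 0))) C] := @constr_C2 _ G k i; exact: (@Cdiff_continuous _ _ 1 _ C).
have E w : box_field p w 0 (rshift _ a) =
  -1 * constr G _ (tagnat.sig2 a) (block_pair _ (lsubmx w, wpar p (tagnat.sig1 a)))
     + upar p _ 0 (tagnat.sig2 a).
  by rewrite /box_field row_mxEr !mxE /slack opprB mulN1r addrC !mxE.
have -> : (fun w => box_field p w 0 (rshift _ a)) = _ := funext E.
apply: continuous_add; last exact: cst_continuous.
apply: continuous_mul; first exact: cst_continuous.
by apply: (cC _ (constr G _ (tagnat.sig2 a))); exact: (@Cdiff_continuous _ _ 2 _ (@constr_C2 _ _ _ _)).
Qed.

(** A sup-norm ball is a box, so the coordinatewise sign conditions add up over a block to the
    inequality [box_vi]. *)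
Lemma box_solution_exists r p : 0 < r ->
  (forall k (i : 'I_(dimu G k)), (neqc G k <= i)%N -> 0 <= lblock lbar k 0 i) ->
  exists x l, box_solution r p x l.
Proof.
move=> r0 lb0.
pose lo : 'rV[R]_(\sum_j dimx G j + \sum_j dimu G j) :=
  row_mx (xbar - const_mx r) (\mxrow_k \row_i mult_lo lbar (i : 'I_(dimu G k))).
pose hi : 'rV[R]_(\sum_j dimx G j + \sum_j dimu G j) :=
  row_mx (xbar + const_mx r) (\mxrow_k \row_i mult_hi lbar (i : 'I_(dimu G k))).
have [j|w Hw] := @box_variational_inequality R _ (fun j w => box_field p w 0 j) lo hi
    (@box_field_continuous p).
  rewrite /lo /hi; case: (split_ordP j) => a ->.
    by rewrite !row_mxEl !mxE ltrD2l gt0_cp.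
  rewrite !row_mxEr !mxE.
  apply: (@le_lt_trans _ _ (lblock lbar _ 0 (tagnat.sig2 a))); last by rewrite ltrDl.
  by rewrite /mult_lo; case: ltnP => ik; [rewrite gerDl lerN10 | exact: lb0].
exists (lsubmx w), (rsubmx w); set x : strat G := lsubmx w; set l : mult G := rsubmx w.
have Hx k (a : 'I_(dimx G k)) : let F := 'D_(emb (delta_mx 0 a : 'rV[R]_(dimx G k)), 0)
       (ell (lblock l k)) (x, wpar p k) - vpar p k 0 a in
   [/\ xblock xbar k 0 a - r <= xblock x k 0 a <= xblock xbar k 0 a + r,
     xblock x k 0 a < xblock xbar k 0 a + r -> 0 <= F
   & xblock xbar k 0 a - r < xblock x k 0 a -> F <= 0].
  have := Hw (lshift _ (tagnat.Rank k a)).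
  by rewrite /lo /hi /box_field !row_mxEl mxrow_Rank !mxE.
have Hl k (i : 'I_(dimu G k)) :
   [/\ mult_lo lbar i <= lblock l k 0 i <= mult_hi lbar i,
     lblock l k 0 i < mult_hi lbar i -> 0 <= - slack p x i
   & mult_lo lbar i < lblock l k 0 i -> - slack p x i <= 0].
  have := Hw (rshift _ (tagnat.Rank k i)).
  rewrite /lo /hi /box_field !row_mxEr !mxrow_Rank.
  by rewrite ![(\row__ _) _ _]mxE /lblock !mxE.
split.
- apply: mxrow_norm_le => [|k]; first exact: ltW.
  apply: row_norm_le => [|a]; first exact: ltW.
  have [+ _ _] := Hx k a; rewrite submxrowB !mxE ler_norml => /andP[h1 h2].
  by apply/andP; split; move: h1 h2; lra.
- move=> k z zr; set h := z - xblock x k.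
  rewrite (emb_sum h) -pair0_sum derive_suml; last exact: ell_differentiable.
  rewrite -subr_ge0 dotrowE -sumrB; apply: sumr_ge0 => a _.
  rewrite (mulrC (vpar p k 0 a)) -mulrBr.
  have /andP[z1 z2] : - r <= z 0 a - xblock xbar k 0 a <= r.
    rewrite -ler_norml (le_trans _ zr) //; have := row_norm_coord (z - xblock xbar k) a.
    by rewrite !mxE.
  have [_ F1 F2] := Hx k a.
  have ha : h 0 a = z 0 a - xblock x k 0 a by rewrite !mxE.
  case: (ltgtP (h 0 a) 0) => [hneg|hpos|->]; last by rewrite mul0r.
    apply: mulr_le0; first exact: ltW.
    by apply: F2; move: hneg z1; rewrite ha; lra.
  apply: mulr_ge0; first exact: ltW.
  by apply: F1; move: hpos z2; rewrite ha; lra.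
- by move=> k i; have [] := Hl k i.
- by move=> k i h; have [_ /(_ h) + _] := Hl k i; rewrite oppr_ge0.
- by move=> k i h; have [_ _ /(_ h)] := Hl k i; rewrite oppr_le0.
Qed.

(** Strictly inside the box the inequality can be tested in opposite directions, which gives
    stationarity, and the one multiplier bound that can be attained is the genuine bound 0. *)
Lemma box_solution_KKT r p x l : 
  `|x - xbar| < r -> `|l - lbar| < 1 -> box_solution r p x l -> S_KKT p (x, l).
Proof.
move=> xr lr bs k /=; split.
  apply: dotrow_inj => h; apply/eqP; rewrite eq_le.
  have le u : dotrow (vpar p k) u <= dotrow (xblock (grad (lagrangian (lblock l k) (wpar p k)) x) k) u.
    (* Keeps the test point within distance [r]; the [+ 1] covers u = 0. *)
    pose s := (r - `|x - xbar|) / (`|u| + 1).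
    have u1 : 0 < `|u| + 1 by rewrite ltr_wpDl.
    have s0 : 0 < s by rewrite divr_gt0 // subr_gt0.
    have zE : xblock x k + s *: u - xblock x k = s *: u by rewrite addrC addKr.
    have := box_vi bs (z := xblock x k + s *: u); rewrite zE -dotrow_grad_lagrangian !dotrowZr.
    rewrite ler_pM2l //; apply.
    rewrite addrAC -xblockB (le_trans (ler_normD _ _)) //.
    rewrite -lerBrDl (@le_trans _ _ (r - `|x - xbar|)) //; last by rewrite lerD2l lerN2 xblock_norm.
    rewrite normrZ gtr0_norm // /s -mulrA ler_piMr //; first by rewrite subr_ge0 ltW.
    by rewrite mulrC ler_pdivrMr // mul1r lerDl.
  by rewrite le /= -lerN2 -!dotrowNr le.
move=> i.
have sg : `|lblock l k 0 i - lblock lbar k 0 i| < 1.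
  have -> : lblock l k 0 i - lblock lbar k 0 i = lblock (l - lbar) k 0 i by rewrite !mxE.
  by rewrite (le_lt_trans (row_norm_coord _ _)) // (le_lt_trans (submxrow_norm _ _)).
move: sg; rewrite ltr_norml => /andP[s1 s2].
have lhi : lblock l k 0 i < mult_hi lbar i by move: s2; rewrite /mult_hi; lra.
have sle := box_slack_le bs lhi.
have sge := @box_slack_ge _ _ _ _ _ _ _ _ bs k i.
have /andP[llo _] := box_l bs i.
move: sge llo; rewrite /mult_lo; case: ifP => ik sge llo.
  have /sge s0 : lblock lbar k 0 i - 1 < lblock l k 0 i by move: s1; lra.
  by apply/eqP; rewrite -subr_eq0 eq_le; apply/andP.
split => //; first by rewrite -subr_le0.
move: llo; rewrite le_eqVlt => /orP[/eqP <-|/sge s0]; first by rewrite mul0r.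
suff -> : constr G k i (xblock x k, wpar p k) - upar p k 0 i = 0 by rewrite mulr0.
by apply/eqP; rewrite eq_le; apply/andP.
Qed.

(** Through this converse the calmness estimate reaches every KKT point near the reference point. *)
Lemma KKT_box_solution r p x l :
  `|x - xbar| <= r -> `|l - lbar| <= 1 -> S_KKT p (x, l) -> box_solution r p x l.
Proof.
move=> xr lr hK; split => //.
- move=> k z _; rewrite -dotrow_grad_lagrangian.
  by have [<- _] := hK k.
- move=> k i; have [_ /(_ i) /=] := hK k.
  have : `|lblock l k 0 i - lblock lbar k 0 i| <= 1.
    have -> : lblock l k 0 i - lblock lbar k 0 i = lblock (l - lbar) k 0 i by rewrite !mxE.
    by rewrite (le_trans (row_norm_coord _ _)) // (le_trans (submxrow_norm _ _)).
  rewrite ler_norml /mult_lo /mult_hi => /andP[h1 h2]; case: ifP => _ H.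
    by apply/andP; split; move: h1 h2; lra.
  by case: H => l0 _ _; rewrite l0 /=; move: h2; lra.
- move=> k i _; have [_ /(_ i) /=] := hK k; rewrite /slack subr_le0; case: ifP => _; first by move=> ->.
  by case.
- move=> k i; have [_ /(_ i) /=] := hK k; rewrite /slack /mult_lo; case: ifP => _; first by move=> -> _; rewrite subrr.
  by move=> [_ _ /eqP]; rewrite mulf_eq0 => /orP[/eqP -> |/eqP -> //]; rewrite ltxx.
Qed.

End Existence.

Theorem theorem5p2 (R : realType) (G : NEP R)
    (pbar : param G) (xbar : strat G) (lbar : mult G)
    (hKKT : S_KKT pbar (xbar, lbar))
    (hconv : convex_assumptions G)
    (hSMFCQ : forall k : 'I_(nplayers G), SMFCQ pbar xbar lbar k)
    (hP : P_property pbar xbar lbar (Kcone pbar xbar lbar)) :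
  robust_isolated_calm (@S_KKT R G) pbar (xbar, lbar) /\
  (\forall q \near (pbar, (xbar, lbar)),
     S_KKT q.1 q.2 -> nash_equilibrium q.1 q.2.1).
Proof.
split; last first.
  exists (setT, setT); first by split; exact: filterT.
  by move=> [p [x l]] _; exact: S_KKT_nash.
split => //.
have [kappa k0 [r r0 [d d0 H]]] := box_solution_calm hKKT hconv hSMFCQ hP.
exists kappa; split; first exact: ltW.
(* Here 1 is the distance from lbar to the artificial multiplier bounds. *)
pose rho := Num.min r 1.
have rho0 : 0 < rho by rewrite lt_min r0 ltr01.
(* The calmness bound is then at most rho / 2, so truncated solutions lie strictly inside the
   box. *)
pose d' := Num.min d (rho / (2 * kappa)).
have d'0 : 0 < d' by rewrite lt_min d0 divr_gt0 // mulr_gt0.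
exists (ball pbar d'), (ball (xbar, lbar) rho); split; first by split; [exact: ball_open | exact: ballxx].
split; first by split; [exact: ball_open | exact: ballxx].
move=> p; rewrite -ball_normE /ball_ /= distrC lt_min => /andP[pd pd'].
have ke : kappa * `|p - pbar| < rho.
  apply: (@le_lt_trans _ _ (rho / 2)); last by rewrite gtr_pMr // invf_lt1 // ltr1n.
  have -> : rho / 2 = kappa * (rho / (2 * kappa)) by field; rewrite gt_eqF.
  by rewrite ler_pM2l // ltW.
have [rr r1] : rho <= r /\ rho <= 1 by rewrite /rho !ge_min !lexx orbT.
have inV x l : `|x - xbar| < rho -> `|l - lbar| < rho -> ball (xbar, lbar) rho (x, l).
  move=> xr lr; rewrite -ball_normE /ball_ /= distrC.
  by rewrite prod_normE gt_max xr lr.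
split.
  have [k i ik|x [l bs]] := @box_solution_exists R G xbar lbar r p r0.
    exact: lbar_ge0 hKKT _ _ ik.
  have [xe le] := H p x l (ltW pd) bs.
  have xr := le_lt_trans xe ke; have lr := le_lt_trans le ke.
  exists (x, l); split; last exact: inV.
  exact: box_solution_KKT (lt_le_trans xr rr) (lt_le_trans lr r1) bs.
move=> [x l] [hK]; rewrite -ball_normE /ball_ /= distrC prod_normE gt_max => /andP[/= xr lr].
have bs := KKT_box_solution (le_trans (ltW xr) rr) (le_trans (ltW lr) r1) hK.
have [xe le] := H p x l (ltW pd) bs.
set K := kappa * `|p - pbar| in xe le ke *.
have dist : `|(x, l) - (xbar, lbar)| <= K by rewrite prod_normE ge_max xe le.
(* Rescaling to the unit ball divides by [K]; when [K] is 0 the point is the reference point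
   itself. *)
have [K0|K0] := eqVneq K 0.
  exists 0; first by rewrite /= normr0.
  move: dist; rewrite K0 normr_le0 subr_eq0 => /eqP ->.
  by rewrite scaler0 addr0.
have Kpos : 0 < K by rewrite lt_neqAle eq_sym K0 mulr_ge0 // ltW.
exists (K^-1 *: ((x, l) - (xbar, lbar))).
  by rewrite /= normrZ gtr0_norm ?invr_gt0 // mulrC ler_pdivrMr // mul1r.
by rewrite scalerA divff // scale1r subrKC.
Qed.
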